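(* Let $\nu$ be a locally finite Borel measure on $\mathbb R^{\mathbf N}$, let $\Sigma=\operatorname{supp}\nu$, and assume that $\nu$ is Ahlfors regular of some order $s>\mathbf N-2l$, that is, there exist constants $c_\nu,c'_\nu>0$ such that $$\nu(Q_d(x))\le c_\nu d^s\quad (x\in\Sigma,\ d>0),\qquad \nu(Q_d(x))\ge c'_\nu d^s\quad(x\in\Sigma,\ 0<d\le\operatorname{diam}\Sigma).$$ Let $V\ge0$ and $V\in L^\varkappa(\Sigma;\nu)$, where $$\varkappa=\frac{s+2l\gamma}{s-\mathbf N+2l},\qquad\gamma>0,$$ and let $\mu=V\nu$. Then, for every $\tau>0$, $$\int_{\mathbb R^{\mathbf N}}\bigl(q^*_{\mu,\tau}(x)\bigr)^{\frac{\mathbf N}{2l}+\gamma}dx\ \le\ C\int_\Sigma V^\varkappa\,d\nu,$$ where $C$ depends only on $\mathbf N,l,s,\gamma,\tau,c_\nu,c'_\nu$.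
   Context: $\mathbf N,l\in\mathbb N$ are fixed with $2l<\mathbf N$. All measures are non-negative. An orthonormal coordinate system is fixed, chosen so that $\mu(\partial Q)=0$ for every cube with edges parallel to the coordinate axes (such a system exists for every Radon measure without point masses). $Q_d(x)$ is the open cube with edges parallel to the axes, center $x$ and edgelength $d$. $\|\nabla^l u\|_{L^2(\mathbb R^{\mathbf N})}^2=\sum_{|\alpha|=l}\frac{l!}{\alpha!}\int|D^\alpha u|^2dx$. For compact $K$, $\operatorname{Cap}_l(K)=\inf\{\|\nabla^l u\|^2_{L^2(\mathbb R^{\mathbf N})}:u\in C_0^\infty(\mathbb R^{\mathbf N}),\ u\ge1\text{ on }K\}$. The inner capacity of a set is the supremum of $\operatorname{Cap}_l$ over its compact subsets; the outer capacity is the infimum of the capacities of open sets containing it; for Borel sets these coincide and are denoted $\operatorname{Cap}_l$. For Borel $E$ with $\operatorname{Cap}_l(E)>0$, $Z_\mu(E)=\mu(E)/\operatorname{Cap}_l(E)$. Otelbaev function: for $\tau>0$, $\delta_{\mu,\tau}(x)=\sup\{d>0:\ \sup_{E\subset Q_d(x)}Z_\mu(E)<1/\tau\}$, the inner supremum being over Borel sets $E$ of positive capacity, and $q^*_{\mu,\tau}(x)=\delta_{\mu,\tau}(x)^{-2l}$ (equal to $0$ if $\delta_{\mu,\tau}(x)=\infty$). (Under the hypotheses of the claim, $\lim_{d\to0}\sup_x\sup_{E\subset Q_d(x)}Z_\mu(E)=0$, so $\delta_{\mu,\tau}(x)\in(0,\infty]$ is well defined.) *)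

(* Defs.v *)
From HB Require Import structures.
From mathcomp Require Import all_boot all_order all_algebra.
From mathcomp Require Import all_classical all_reals all_analysis.
From mathcomp Require Import lra.

Set Implicit Arguments.
Unset Strict Implicit.
Unset Printing Implicit Defensive.

Import Order.TTheory GRing.Theory Num.Theory.
Import numFieldNormedType.Exports.

Local Open Scope classical_set_scope.
Local Open Scope ring_scope.

(* R^n is the type of row vectors, with its Borel sigma-algebra. *)
Section borel.
Variables (R : realType) (n : nat).

HB.instance Definition _ := @isMeasurable.Build (sigma_display (@open 'rV[R]_n))
  'rV[R]_n <<s @open 'rV[R]_n >> (@sigma_algebra0 _ setT (@open 'rV[R]_n))
  (@sigma_algebraC _ (@open 'rV[R]_n)) (@sigma_algebra_bigcup _ setT (@open 'rV[R]_n)).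

Definition row_of_tuple (t : n.-tuple (measurableTypeR R)) : 'rV[R]_n :=
  \row_i tnth t i.

Lemma measurable_row_of_tuple_box (A : 'I_n -> set (measurableTypeR R)) :
  (forall i, measurable (A i)) ->
  measurable [set t : n.-tuple (measurableTypeR R) | forall i, A i (tnth t i)].
Proof.
move=> mA.
rewrite (_ : [set _ | _] = \bigcap_(i in setT) (@tnth _ _ ^~ i) @^-1` (A i)); last first.
  by apply/seteqP; split=> [t h i _|t h i]; [exact: h|exact: (h i)].
apply: fin_bigcap_measurable; first exact: finite_finset.
move=> i _; rewrite -[X in measurable X]setTI.
exact: (measurable_tnth i measurableT (mA i)).
Qed.

Lemma measurable_row_of_tuple : measurable_fun setT row_of_tuple.
Proof.
apply: (measurability (@open 'rV[R]_n)) => // _ [U oU <-].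
pose B (p : 'rV[rat]_n * rat) : set 'rV[R]_n :=
  [set x | forall i, `]ratr (p.1 ord0 i) - ratr p.2, ratr (p.1 ord0 i) + ratr p.2[%classic (x ord0 i)].
have -> : setT `&` row_of_tuple @^-1` U =
    \bigcup_(p in [set p | B p `<=` U]) (row_of_tuple @^-1` (B p)).
  rewrite setTI; apply/seteqP; split=> [t Ut|t [p /= pU] /pU//].
  have /nbhs_ballP[e /= e0 eU] := open_nbhs_nbhs (conj oU Ut).
  have [r] : exists r : rat, ratr r \in `]0, (e / 2)[.
    by apply: rat_in_itvoo; rewrite divr_gt0.
  rewrite in_itv/= => /andP[r0 re].
  have hq i : exists q : rat, ratr q \in `](tnth t i - ratr r), (tnth t i + ratr r)[.
    by apply: rat_in_itvoo; rewrite ltrD2l (lt_trans _ r0)// oppr_lt0.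
  have [q qE] : exists q : 'rV[rat]_n,
      forall i, `|ratr (q ord0 i) - tnth t i| < ratr r.
    exists (\row_i projT1 (cid (hq i))) => i.
    rewrite mxE; case: cid => /= x; rewrite in_itv/= => /andP[h1 h2].
    by rewrite ltr_norml; apply/andP; split; lra.
  exists (q, r) => /=.
    move=> x Bx; apply: eU; split=> // i j; rewrite ord1 mxE /ball /=.
    have := Bx j; rewrite /= in_itv/= => /andP[h1 h2].
    have := qE j; rewrite !ltr_norml => /andP[h3 h4].
    by apply/andP; split; lra.
  move=> i /=; rewrite in_itv /= mxE.
  have := qE i; rewrite ltr_norml => /andP[h1 h2].
  by apply/andP; split; lra.
rewrite bigcup_mkcond; apply: countable_bigcupT_measurable => // p.
case: ifP => _; last exact: measurable0.
rewrite (_ : _ @^-1` _ = [set t | forall i, `]ratr (p.1 ord0 i) - ratr p.2,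
    ratr (p.1 ord0 i) + ratr p.2[%classic (tnth t i)]).
  by apply: (@measurable_row_of_tuple_box (fun i => `]ratr (p.1 ord0 i) - ratr p.2, ratr (p.1 ord0 i) + ratr p.2[%classic)) => i; exact: measurable_itv.
by apply/seteqP; split=> t /= h i; have := h i; rewrite mxE.
Qed.

End borel.

(* Lebesgue measure on R^(n+1) as the image of the product of the measures on R
   and on R^n under (a, t) |-> a :: t. *)
Section lebesgue_tuple_succ.
Variables (R : realType) (n : nat).
Local Notation T := (measurableTypeR R).
Variable m : {sigma_finite_measure set (n.-tuple T) -> \bar R}.

Definition tuple_cons (p : T * n.-tuple T) : n.+1.-tuple T :=
  [tuple of p.1 :: p.2].

Lemma measurable_tuple_cons : measurable_fun setT tuple_cons.
Proof. exact: measurable_cons. Qed.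

Let mlam := [the measure _ _ of
  measure_function_pushforward__canonical__measure_function_Measure
    (lebesgue_measure \x m)%E measurable_tuple_cons].

Definition cons_lebesgue : set (n.+1.-tuple T) -> \bar R :=
  pushforward (lebesgue_measure \x m)%E tuple_cons.

HB.instance Definition _ := isMeasure.Build _ _ _ cons_lebesgue
  (measure0 mlam) (measure_ge0 mlam) (@measure_semi_sigma_additive _ _ _ mlam).

Lemma cons_lebesgue_sigma_finite : sigma_finite setT cons_lebesgue.
Proof.
have /sigma_finiteP[F [FT ndF Foo]] := sigma_finiteT (@lebesgue_measure R).
have /sigma_finiteP[G [GT ndG Goo]] := sigma_finiteT m.
pose u (t : n.+1.-tuple T) : T * n.-tuple T := (thead t, [tuple of behead t]).
have mu : measurable_fun setT u.
  apply: measurable_fun_pair; last exact: measurable_behead.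
  exact: measurable_tnth.
exists (fun k => u @^-1` (F k `*` G k)).
  apply/esym; rewrite -subTset => t _.
  have [i _ Fi] : (\bigcup_i F i) (u t).1 by rewrite -FT.
  have [j _ Gj] : (\bigcup_j G j) (u t).2 by rewrite -GT.
  exists (maxn i j) => //; split.
    by move: Fi; exact/subsetPset/ndF/leq_maxl.
  by move: Gj; exact/subsetPset/ndG/leq_maxr.
move=> k; have [mF Fk] := Foo k; have [mG Gk] := Goo k; split.
  by rewrite -[X in measurable X]setTI; apply: mu => //; exact: measurableX.
rewrite /cons_lebesgue /pushforward -comp_preimage (_ : u \o tuple_cons = id).
  by rewrite preimage_id product_measure1E// lte_mul_pinfty// ge0_fin_numE.
by apply/funext => -[a t] /=; rewrite /u theadE; congr pair; exact: val_inj.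
Qed.

HB.instance Definition _ :=
  Measure_isSigmaFinite.Build _ _ _ cons_lebesgue cons_lebesgue_sigma_finite.

End lebesgue_tuple_succ.


(* lebesgue_row is Lebesgue measure on R^n; lebesgue_row_box below gives its
   values on products of Borel sets. *)
Section lebesgue_row.
Variable R : realType.
Local Notation T := (measurableTypeR R).

Fixpoint lebesgue_tuple n : {sigma_finite_measure set (n.-tuple T) -> \bar R} :=
  if n is k.+1 then cons_lebesgue (lebesgue_tuple k) else \d_([tuple] : 0.-tuple T).

Variable n : nat.

Let mlam := [the measure _ _ of
  measure_function_pushforward__canonical__measure_function_Measure
    (lebesgue_tuple n) (@measurable_row_of_tuple R n)].

Definition lebesgue_row : set 'rV[R]_n -> \bar R :=
  pushforward (lebesgue_tuple n) (@row_of_tuple R n).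

HB.instance Definition _ := isMeasure.Build _ _ _ lebesgue_row
  (measure0 mlam) (measure_ge0 mlam) (@measure_semi_sigma_additive _ _ _ mlam).

End lebesgue_row.

Lemma lebesgue_tuple_box (R : realType) n (A : 'I_n -> set (measurableTypeR R)) :
  (forall i, measurable (A i)) ->
  lebesgue_tuple R n [set t | forall i, A i (tnth t i)] =
  (\prod_(i < n) lebesgue_measure (A i))%E.
Proof.
elim: n A => [|n IHn] A mA.
  by rewrite big_ord0 /= diracE mem_set//= => -[].
rewrite big_ord_recl /= /cons_lebesgue /pushforward.
rewrite -IHn; last by move=> i; exact: mA.
rewrite -product_measure1E; [|exact: mA|]; last first.
  by apply: (@measurable_row_of_tuple_box _ _ (fun i => A (lift ord0 i))).
congr ((_ \x _)%E _); apply/seteqP; split=> -[a t] /=.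
  move=> h; split; first exact: (h ord0).
  by move=> i; have := h (lift ord0 i); rewrite tnthS.
move=> [h0 h] i; case: (unliftP ord0 i) => [j|] ->; last exact: h0.
by rewrite tnthS; exact: h.
Qed.

Lemma lebesgue_row_box (R : realType) n (A : 'I_n -> set (measurableTypeR R)) :
  (forall i, measurable (A i)) ->
  lebesgue_row [set x : 'rV[R]_n | forall i, A i (x ord0 i)] =
  (\prod_(i < n) lebesgue_measure (A i))%E.
Proof.
move=> mA; rewrite -lebesgue_tuple_box// /lebesgue_row /pushforward.
by congr (lebesgue_tuple R n _); apply/seteqP; split=> t /= h i;
  have := h i; rewrite mxE.
Qed.

Section euclidean.
Variables (R : realType) (n : nat).
Implicit Types (x y : 'rV[R]_n) (E : set 'rV[R]_n) (nu : set 'rV[R]_n -> \bar R).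

Definition euclidean_dist x y : R :=
  Num.sqrt (\sum_(i < n) (x ord0 i - y ord0 i) ^+ 2).

(* This is -oo for the empty set. *)
Definition ediam E : \bar R :=
  ereal_sup [set (euclidean_dist x y)%:E | x in E & y in E].

Definition cube x (d : R) : set 'rV[R]_n :=
  [set y | forall i, `|y ord0 i - x ord0 i| < d / 2].

Definition boundary E : set 'rV[R]_n := closure E `\` interior E.

Definition msupport nu : set 'rV[R]_n :=
  [set x | forall U, open U -> U x -> (0 < nu U)%E].

Definition locally_finite nu : Prop :=
  forall x, exists2 U, open U /\ U x & (nu U < +oo)%E.

Definition ahlfors_regular nu (s c c' : R) : Prop :=
  (forall x d, msupport nu x -> 0 < d -> (nu (cube x d) <= (c * d `^ s)%:E)%E) /\
  (forall x d, msupport nu x -> 0 < d -> (d%:E <= ediam (msupport nu))%E ->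
    ((c' * d `^ s)%:E <= nu (cube x d))%E).

(* The measure V nu, for V given on a set D carrying nu. *)
Definition density_measure nu (D : set 'rV[R]_n) (V : 'rV[R]_n -> R) :
    set 'rV[R]_n -> \bar R :=
  fun A => (\int[nu]_(x in A `&` D) (V x)%:E)%E.

End euclidean.

Section capacity.
Variables (R : realType) (n : nat).
Implicit Types (u : 'rV[R]_n -> R) (K E : set 'rV[R]_n).

Definition unit_vector (i : 'I_n) : 'rV[R]_n := delta_mx ord0 i.

Definition partial (i : 'I_n) u : 'rV[R]_n -> R := 'D_(unit_vector i) u.

Definition multi_partial (alpha : 'I_n -> nat) u : 'rV[R]_n -> R :=
  foldr (fun i v => iter (alpha i) (partial i) v) u (enum 'I_n).

(* All iterated partial derivatives, in every order, exist and are continuous. *)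
Definition smooth u : Prop := forall s : seq 'I_n,
  continuous (foldr partial u s) /\
  forall i x, derivable (foldr partial u s) x (unit_vector i).

Definition test_function u : Prop :=
  smooth u /\ compact (closure [set x | u x != 0]).

(* Multi-indices of length l have all entries at most l. *)
Definition grad_norm2 (l : nat) u : \bar R :=
  (\sum_(alpha : {ffun 'I_n -> 'I_l.+1} | (\sum_i alpha i)%N == l)
     ((l`!)%:R / (\prod_i (alpha i)`!)%:R)%:E *
     \int[@lebesgue_row R n]_x
       (`|multi_partial (fun i => alpha i) u x| ^+ 2)%:E)%E.

Definition compact_cap (l : nat) K : \bar R :=
  ereal_inf [set grad_norm2 l u | u in
    [set u | test_function u /\ forall x, K x -> 1 <= u x]].

(* Inner capacity; on Borel sets it equals the outer capacity, so there it is
   the capacity Cap_l. *)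
Definition cap (l : nat) E : \bar R :=
  ereal_sup [set compact_cap l K | K in [set K | compact K /\ K `<=` E]].

End capacity.

Section otelbaev.
Variables (R : realType) (n l : nat) (mu : set 'rV[R]_n -> \bar R) (tau : R).
Local Open Scope ereal_scope.

Definition capacity_ratio (E : set 'rV[R]_n) : \bar R := mu E / cap l E.

Definition cube_concentration (x : 'rV[R]_n) (d : R) : \bar R :=
  ereal_sup [set capacity_ratio E | E in
    [set E | [/\ measurable E, E `<=` cube x d & 0 < cap l E]]].

(* The maximum with 0 makes the supremum of the empty set 0. *)
Definition otelbaev_delta (x : 'rV[R]_n) : \bar R :=
  maxe 0 (ereal_sup [set d%:E | d in
    [set d : R | (0 < d)%R /\ cube_concentration x d < (tau^-1)%:E]]).

(* In \bar R, the inverse of +oo is 0 and the inverse of 0 is +oo. *)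
Definition otelbaev_q (x : 'rV[R]_n) : \bar R :=
  (otelbaev_delta x ^+ (2 * l))^-1.

End otelbaev.

(* Main.v *)
(* Put sigma = s - N + 2l and beta = (N - 2l)/s = 1 - sigma/s.

   The fundamental theorem of calculus along rays, averaged over directions,
   bounds |u(x)| by the Riesz potential of order 1 of sum_i |d_i u|; iterating,
   and composing the kernels, |u| <= C I_l(sum |D^alpha u|).  By duality,
   nu(K)^2 <= C ||nabla^l u||^2 ||I_l nu_K||^2 when u >= 1 on K, and
   ||I_l nu_K||^2 is at most a multiple of the energy of order 2l of nu_K, which
   is O(nu(K)^(2 - beta)) because nu(Q_d) = O(d^s) with s > N - 2l.  Hence
   nu(E)^beta <= C Cap_l(E).

   In a cube of edge t the part of V below h0 t^(-sigma) contributes little to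
   mu(E)/Cap_l(E), so delta(x) < t forces
     int_{Q_t(x)} V^(s/sigma) 1[V > h0 t^(-sigma)] dnu >= e.
   Here the cube has the prescribed size t, so no covering argument is needed:
   write delta^(-N - 2l gamma) as a dyadic sum over t > delta, integrate in x by
   Tonelli, and sum the geometric series sum_{t^sigma > h0/V} t^(-2l gamma).
   The result is a multiple of V^(s/sigma + 2l gamma/sigma) = V^kappa. *)
From HB Require Import structures.
Require Import Defs.
From mathcomp Require Import all_boot all_order all_algebra.
From mathcomp Require Import all_classical all_reals all_analysis.
From mathcomp Require Import measurable_realfun ring lra.

Set Implicit Arguments.
Unset Strict Implicit.
Unset Printing Implicit Defensive.

Import Order.TTheory GRing.Theory Num.Theory.
Import numFieldNormedType.Exports.

Local Open Scope classical_set_scope.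
Local Open Scope ring_scope.

(** * Sums over the integers and dyadic scales *)

(** The exponent s/sigma is the scale-invariant one: t^s (t^(-sigma))^(s/sigma) = 1, so a single
    threshold e serves cubes of every size. The cut at h0 t^(-sigma) is what makes the sum over
    scales converge: integrating t^(-N - 2l gamma) 1_{Q_t(x)}(y) in x leaves t^(-2l gamma), whose
    sum over all dyadic t diverges at t = 0; for a given value of V the cut discards exactly the
    small t. All kernels are dyadic sums of indicators of sup-norm balls. These balls are the cubes
    of the statement, so composing kernels and estimating potentials reduce to volumes of boxes and
    geometric series, without polar coordinates. For the same reason the directions of the rays are
    averaged over a unit cube instead of a sphere. The duality step uses Young's inequality with a
    weight instead of Cauchy-Schwarz: the weight is tuned so that the energy term is at most half of
    the mass and is absorbed. *)

Section zsum.
Context {R : realType}.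
Local Open Scope ereal_scope.
Implicit Types (f g : int -> \bar R).

Definition zsum f : \bar R := \esum_(k in [set: int]) f k.

(** Even indices list the non-negative integers and odd ones the negative integers; through this
    enumeration the monotone convergence results for sequences apply to sums over all scales. *)
Definition int_of_nat (n : nat) : int := if odd n then Negz n./2 else Posz n./2.

Lemma int_of_nat_bij : set_bij [set: nat] [set: int] int_of_nat.
Proof.
have zed (z : int) : int_of_nat (if z is Posz m then m.*2 else
    if z is Negz m then m.*2.+1 else 0%N) = z.
  by case: z => m; rewrite /int_of_nat /= odd_double /= ?doubleK ?uphalf_double.
split => //; last by move=> z _; eexists; [|exact: zed].
move=> n m _ _; have := odd_double_half m; have := odd_double_half n.
by rewrite /int_of_nat; case: odd; case: odd => // En Em -[E]; rewrite -En -Em E.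
Qed.

Lemma zsumE f : (forall k, 0 <= f k) -> zsum f = \sum_(n <oo) f (int_of_nat n).
Proof.
move=> f0; rewrite nneseries_esumT; last by move=> n; exact: f0.
exact: (reindex_esum _ _ _ _ int_of_nat_bij).
Qed.

Lemma zsum_ge0 f : (forall k, 0 <= f k) -> 0 <= zsum f.
Proof. by move=> f0; apply: esum_ge0. Qed.

Lemma le_zsum f g : (forall k, f k <= g k) -> zsum f <= zsum g.
Proof. by move=> fg; apply: le_esum. Qed.

Lemma zsum_ge f k : f k <= zsum f.
Proof.
apply: esum_ge; exists [set k]; first by split => //; exact: finite_set1.
by rewrite fsbig_set1.
Qed.

Lemma zsumD f g : (forall k, 0 <= f k) -> (forall k, 0 <= g k) ->
  zsum (fun k => f k + g k) = zsum f + zsum g.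
Proof. by move=> f0 g0; apply: esumD => *. Qed.

Lemma zsumZl (c : R) f : (0 <= c)%R -> (forall k, 0 <= f k) ->
  zsum (fun k => c%:E * f k) = c%:E * zsum f.
Proof.
move=> c0 f0; rewrite !zsumE//; first by rewrite nneseriesZl// => n _; exact: f0.
by move=> k; rewrite mule_ge0.
Qed.

Lemma zsum_shift f (d : int) : zsum (fun k => f (k + d)%R) = zsum f.
Proof.
apply/esym/(reindex_esum setT setT (fun k : int => k + d)%R); split => //.
- by move=> i j _ _ /addIr.
- by move=> i _; exists (i - d)%R => //=; rewrite subrK.
Qed.

Lemma zsum_interchange (a : int -> int -> \bar R) : (forall i j, 0 <= a i j) ->
  zsum (fun i => zsum (a i)) = zsum (fun j => zsum (a ^~ j)).
Proof.
move=> a0; rewrite /zsum !esum_esum//.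
rewrite [RHS](reindex_esum (setT `*`` (fun=> setT)) _ (fun x => (x.2, x.1)))//.
split=> //= [[i1 i2] [j1 j2] /= _ _ [] -> -> //|[i1 i2] _ /=].
by exists (i2, i1).
Qed.

Lemma integral_zsum d (T : measurableType d) (mu : {measure set T -> \bar R})
    (f : int -> T -> \bar R) :
  (forall k, measurable_fun [set: T] (f k)) -> (forall k x, 0 <= f k x) ->
  \int[mu]_x zsum (f ^~ x) = zsum (fun k => \int[mu]_x f k x).
Proof.
move=> mf f0; rewrite zsumE; last by move=> k; exact: integral_ge0.
by rewrite -integral_nneseries//; apply: eq_integral => x _; rewrite zsumE.
Qed.

Lemma measurable_zsum d (T : measurableType d) (f : int -> T -> \bar R) :
  (forall k, measurable_fun [set: T] (f k)) -> (forall k x, 0 <= f k x) ->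
  measurable_fun [set: T] (fun x => zsum (f ^~ x)).
Proof.
move=> mf f0; under eq_fun do rewrite zsumE//.
by apply: ge0_emeasurable_sum => // n x _ _; exact: f0.
Qed.

Lemma geometric_nneseries (a x : R) : (0 <= a)%R -> (0 < x < 1)%R ->
  \sum_(n <oo) (a * x ^+ n)%:E <= (a / (1 - x))%:E.
Proof.
move=> a0 /andP[x0 x1].
have t0 n : (0 <= a * x ^+ n)%R by rewrite mulr_ge0// exprn_ge0// ltW.
apply: lime_le; first by apply: is_cvg_nneseries => n _ _; rewrite lee_fin.
apply: nearW => n; rewrite sumEFin lee_fin.
by apply: geometric_le_lim => //; rewrite ger0_norm// ltW.
Qed.

End zsum.

Section dyadic.
Context {R : realType}.

Definition dyadic (k : int) : R := 2 `^ k%:~R.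

Lemma dyadic_gt0 k : 0 < dyadic k.
Proof. by rewrite powR_gt0. Qed.
Lemma dyadic_ge0 k : 0 <= dyadic k.
Proof. by rewrite powR_ge0. Qed.
Hint Resolve dyadic_gt0 dyadic_ge0 : core.

Lemma dyadicD j k : dyadic (j + k) = dyadic j * dyadic k.
Proof. by rewrite /dyadic intrD powRD// pnatr_eq0 implybT. Qed.

Lemma dyadic1 : dyadic 1 = 2.
Proof. by rewrite /dyadic powRr1. Qed.

Lemma dyadicS k : dyadic (k + 1) = 2 * dyadic k.
Proof. by rewrite dyadicD dyadic1 mulrC. Qed.

Lemma ler_dyadic j k : (dyadic j <= dyadic k) = (j <= k).
Proof.
apply/idP/idP => [|jk]; last by rewrite ler_powR ?ler_int// ler1n.
apply: contraTT; rewrite -!ltNge => kj.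
suff: dyadic (k + 1) <= dyadic j.
  by apply: lt_le_trans; rewrite dyadicS mulr2n mulrDl mul1r ltrDl.
by rewrite ler_powR ?ler1n// ler_int lezD1.
Qed.

Lemma dyadic_floor (r : R) : 0 < r -> exists k, dyadic k <= r < dyadic (k + 1).
Proof.
move=> r0; exists (Num.floor (ln r / ln 2)).
have l2 : 0 < ln 2 :> R by rewrite ln_gt0// ltr1n.
have /andP[h1 h2] := floor_itv (ln r / ln 2).
rewrite /dyadic /powR pnatr_eq0/= -[X in _ <= X](lnK r0) -[X in X < _](lnK r0).
by rewrite ler_expR ltr_expR -ler_pdivlMr// h1 -ltr_pdivrMr.
Qed.

(** A geometric series of ratio 2^(-b), read downwards from the last scale k0 with [dyadic k0 <= w];
    its largest term is at most w^b. *)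
Lemma dyadic_le_sum (b w : R) : 0 < b -> 0 < w ->
  (zsum (fun k => (dyadic k `^ b * (dyadic k <= w)%R%:R)%:E)
    <= (w `^ b / (1 - 2 `^ (- b)))%:E)%E.
Proof.
move=> b0 w0; have [k0 /andP[k0w wk0]] := dyadic_floor w0.
have q1 : 0 < (2 : R) `^ (- b) < 1.
  rewrite powR_gt0//= powRN invf_lt1 ?powR_gt0//.
  by have := @gt0_ltr_powR R b b0 1 2; rewrite !nnegrE powR1; apply; rewrite ?ltr1n.
have -> : zsum (fun k => (dyadic k `^ b * (dyadic k <= w)%R%:R)%:E) =
   (\sum_(n <oo) (dyadic k0 `^ b * (2 `^ (- b)) ^+ n)%:E)%E.
  rewrite nneseries_esumT; last first.
    by move=> n; rewrite lee_fin mulr_ge0 ?exprn_ge0 ?powR_ge0.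
  rewrite /zsum.
  have -> : \esum_(k in [set: int]) (dyadic k `^ b * (dyadic k <= w)%R%:R)%:E =
     \esum_(k in [set k : int | k <= k0]) (dyadic k `^ b)%:E.
    rewrite [RHS]esum_mkcond; apply: eq_esum => k _.
    case: ifPn; rewrite ?(inE, notin_setE)/= => kk0.
      by rewrite (le_trans _ k0w) ?mulr1// ler_dyadic.
    rewrite leNgt (lt_le_trans wk0) ?mulr0// ler_dyadic lezD1.
    by rewrite ltNge; apply/negP.
  rewrite (reindex_esum setT _ (fun n : nat => k0 - n%:Z)).
    apply: eq_esum => n _; congr EFin; rewrite /dyadic rmorphB/= -!powRrM.
    rewrite -powR_mulrn ?powR_ge0// -powRrM -powRD ?pnatr_eq0 ?implybT//.
    by congr powR; rewrite -pmulrn; ring.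
  split => [n _ /=|n m _ _ /addrI/oppr_inj[]//|z /= zk0].
    by rewrite gerBl.
  exists `|k0 - z|%N => //=; rewrite gez0_abs ?subr_ge0//; ring.
apply: le_trans (geometric_nneseries _ q1) _; first exact: powR_ge0.
rewrite lee_fin; apply: ler_wpM2r.
  by rewrite invr_ge0 subr_ge0; case/andP: q1 => _ /ltW.
by apply: ge0_ler_powR; rewrite ?nnegrE ?(ltW b0) ?(ltW w0) ?(ltW (dyadic_gt0 _)).
Qed.

Lemma dyadicN k : dyadic (- k) = (dyadic k)^-1.
Proof. by rewrite /dyadic rmorphN/= powRN. Qed.

(** Mirror image of the sum over small scales under k -> -k and w -> 1/w. *)
Lemma dyadic_ge_sum (b w : R) : 0 < b -> 0 < w ->
  (zsum (fun k => (dyadic k `^ (- b) * (w <= dyadic k)%R%:R)%:E)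
    <= (w `^ (- b) / (1 - 2 `^ (- b)))%:E)%E.
Proof.
move=> b0 w0; have wi : 0 < w^-1 by rewrite invr_gt0.
have := dyadic_le_sum b0 wi.
rewrite /zsum (reindex_esum setT setT (fun k : int => - k)).
  under eq_esum do rewrite dyadicN lef_pV2 ?posrE//.
  rewrite powRN -(powR_inv1 (ltW w0)) -powRrM mulN1r powRN.
  apply: le_trans; apply: le_esum => k _.
  by rewrite -(powR_inv1 (ltW (dyadic_gt0 _))) -powRrM mulN1r.
split => // [i j _ _ /oppr_inj //|z _]; exists (- z) => //; exact: opprK.
Qed.

End dyadic.
#[export] Hint Resolve dyadic_gt0 dyadic_ge0 : core.

(** * Lebesgue measure on row vectors *)

Section rows.
Context {R : realType} {n : nat}.
Local Notation rV := 'rV[R]_n.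
Implicit Types (a b x y : rV) (A : set rV).

Definition obox a b : set rV :=
  [set x | forall i, `]a ord0 i, b ord0 i[%classic (x ord0 i)].

Lemma row_open_measurable A : open A -> measurable A.
Proof. by move=> oA; exact: sub_sigma_algebra. Qed.

Lemma row_closed_measurable A : closed A -> measurable A.
Proof.
move=> cA; rewrite -(setCK A); apply: measurableC; apply: row_open_measurable.
exact: closed_openC.
Qed.

Lemma row_continuous_measurable (f : rV -> R) :
  continuous f -> measurable_fun [set: rV] f.
Proof.
move=> /continuousP cf; apply: (measurability _ (RGenOpens.measurableE R)).
move=> _ [_ [a [b ->] <-]]; rewrite setTI.
by apply: row_open_measurable; apply: cf; exact: interval_open.
Qed.

Lemma measurable_coord i : measurable_fun [set: rV] (fun x => x ord0 i).
Proof. by apply: row_continuous_measurable => x; exact: coord_continuous. Qed.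

Lemma row_normP x (r : R) : 0 < r -> (`|x| < r) <-> (forall i, `|x ord0 i| < r).
Proof.
move=> r0; rewrite [`|x|]mx_normrE; split => [|h].
  by move=> /bigmax_ltP[_ h] i; exact: (h (ord0, i)).
by apply/bigmax_ltP; split=> // -[j i] _ /=; rewrite (ord1 j).
Qed.

Lemma open_obox a b : open (obox a b).
Proof.
rewrite openE => x xab; rewrite /interior.
have h i : \forall y \near x, `]a ord0 i, b ord0 i[%classic ((y : rV) ord0 i).
  apply: (@coord_continuous R 1 n ord0 i x).
  by apply: open_nbhs_nbhs; split; [exact: interval_open|exact: xab].
exact: filter_forall h.
Qed.

Definition rat_box (p : 'rV[rat]_n * rat) : set rV :=
  obox (\row_i (ratr (p.1 ord0 i) - ratr p.2)) (\row_i (ratr (p.1 ord0 i) + ratr p.2)).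

Lemma rat_box_basis A x : open A -> A x -> exists2 p, rat_box p x & rat_box p `<=` A.
Proof.
move=> oA Ax.
have /nbhs_ballP[e /= e0 eA] := open_nbhs_nbhs (conj oA Ax).
have [r] : exists r : rat, ratr r \in `]0, (e / 2)[.
  by apply: rat_in_itvoo; rewrite divr_gt0.
rewrite in_itv/= => /andP[r0 re].
have hq i : exists q : rat, `|ratr q - x ord0 i| < ratr r.
  have [q] : exists q : rat, ratr q \in `](x ord0 i - ratr r), (x ord0 i + ratr r)[.
    by apply: rat_in_itvoo; rewrite ltrD2l (lt_trans _ r0)// oppr_lt0.
  rewrite in_itv/= => /andP[h1 h2]; exists q.
  by rewrite ltr_norml; apply/andP; split; lra.
pose q := \row_i projT1 (cid (hq i)).
have qE i : `|ratr (q ord0 i) - x ord0 i| < ratr r.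
  by rewrite /q mxE; case: cid.
exists (q, r).
  move=> i /=; rewrite in_itv/= !mxE; have := qE i.
  by rewrite ltr_norml => /andP[h1 h2]; apply/andP; split; rewrite ?mxE in h1 h2 *; lra.
move=> y By; apply: eA; rewrite -ball_normE /ball_ /=; apply/row_normP => // i.
have := By i; rewrite /= in_itv/= !mxE => /andP[h1 h2].
have := qE i; rewrite ltr_norml => /andP[h3 h4].
by rewrite ?mxE in h3 h4 *; rewrite ltr_norml; apply/andP; split; lra.
Qed.

Lemma open_bigcup_rat_box A : open A ->
  A = \bigcup_(p in [set p | rat_box p `<=` A]) rat_box p.
Proof.
move=> oA; apply/seteqP; split=> [x Ax|x [p /= pA] /pA//].
by have [p px pA] := rat_box_basis oA Ax; exists p.
Qed.

Definition oboxes : set (set rV) := [set obox a b | a in setT & b in setT].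

(** Every open set is a countable union of boxes with rational data. Since boxes are stable under
    intersection and [centered_box] exhausts the space, measures finite on boxes can then be
    identified by their values there. *)
Lemma oboxes_measurableE : @measurable _ rV = <<s oboxes >>.
Proof.
apply/seteqP; split; last first.
  apply: smallest_sub; first exact: sigma_algebra_measurable.
  by move=> _ [a _ [b _ <-]]; apply: row_open_measurable; exact: open_obox.
apply: smallest_sub; first exact: smallest_sigma_algebra.
move=> A oA; rewrite (open_bigcup_rat_box oA).
have H : @measurable _ (g_sigma_algebraType oboxes)
    (\bigcup_(p in [set p | rat_box p `<=` A]) rat_box p).
  rewrite bigcup_mkcond; apply: countable_bigcupT_measurable => // p.
  case: ifP => _; last exact: measurable0.
  by apply: sub_sigma_algebra; exists (\row_i (ratr (p.1 ord0 i) - ratr p.2)) => //; eexists.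
exact: H.
Qed.

Lemma setI_closed_oboxes : setI_closed oboxes.
Proof.
move=> _ _ [a _ [b _ <-]] [a' _ [b' _ <-]].
exists (\row_i Num.max (a ord0 i) (a' ord0 i)) => //.
exists (\row_i Num.min (b ord0 i) (b' ord0 i)) => //.
apply/seteqP; split=> x h.
  split=> i; have := h i; rewrite /= !mxE !in_itv/= gt_max lt_min.
    by case/andP => /andP[-> _] /andP[->].
  by case/andP => /andP[_ ->] /andP[_ ->].
case: h => h h' i; have := h i; have := h' i; rewrite /= !mxE !in_itv/= gt_max lt_min.
by move=> /andP[-> ->] /andP[-> ->].
Qed.

Definition centered_box (k : nat) : set rV := obox (const_mx (- k%:R)) (const_mx k%:R).

Lemma bigcup_centered_box : \bigcup_k centered_box k = setT.
Proof.
rewrite -subTset => x _; exists (Num.bound `|x|) => // i /=.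
rewrite in_itv/= !mxE -ltr_norml.
have xb : `|x| < (Num.bound `|x|)%:R by exact: archi_boundP.
have b0 : 0 < (Num.bound `|x|)%:R :> R by rewrite (le_lt_trans _ xb).
by move/(row_normP x b0) : xb.
Qed.

Lemma lebesgue_row_obox a b :
  lebesgue_row (obox a b) = (\prod_(i < n) Num.max 0 (b ord0 i - a ord0 i))%:E.
Proof.
rewrite /obox (@lebesgue_row_box _ _ (fun i => `]a ord0 i, b ord0 i[%classic)); last first.
  by move=> i; exact: measurable_itv.
rewrite (eq_bigr (fun i => (Num.max 0 (b ord0 i - a ord0 i))%:E)).
  by elim/big_ind2 : _ => // x1 x2 y1 y2 -> ->; rewrite EFinM.
move=> i _; rewrite lebesgue_measure_itv/= lte_fin.
by case: ltP => h; [rewrite max_r ?subr_ge0 ?ltW|rewrite max_l ?subr_le0].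
Qed.

Lemma lebesgue_row_sigma_finite : sigma_finite setT (@lebesgue_row R n).
Proof.
exists centered_box; first by rewrite bigcup_centered_box.
move=> k; split; first by apply: row_open_measurable; exact: open_obox.
by rewrite lebesgue_row_obox ltry.
Qed.

HB.instance Definition _ := Measure_isSigmaFinite.Build _ _ _ (@lebesgue_row R n)
  lebesgue_row_sigma_finite.

Lemma measurable_rowP d (T : measurableType d) (f : T -> rV) :
  (forall i, measurable_fun [set: T] (fun t => f t ord0 i)) ->
  measurable_fun [set: T] f.
Proof.
move=> mf; apply: (measurability oboxes oboxes_measurableE).
move=> _ [_ [a _ [b _ <-]] <-]; rewrite setTI.
rewrite (_ : f @^-1` _ = \bigcap_(i in [set: 'I_n])
  (fun t => f t ord0 i) @^-1` `]a ord0 i, b ord0 i[%classic).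
  apply: fin_bigcap_measurable; first exact: finite_finset.
  by move=> i _; rewrite -[X in measurable X]setTI; apply: mf.
by apply/seteqP; split=> [t h i _|t h i]; [exact: (h i)|exact: (h i Logic.I)].
Qed.

Lemma measurable_affine x (r : R) : measurable_fun [set: rV] (fun y => x + r *: y).
Proof.
apply: measurable_rowP => i.
under eq_fun do rewrite !mxE.
by apply: measurable_funD => //; apply: measurable_funM => //; exact: measurable_coord.
Qed.

(** The image of Lebesgue measure under y |-> x + r y and the multiple of Lebesgue measure by r^(-n)
    agree on open boxes, hence everywhere. *)
Lemma integral_affine (f : rV -> \bar R) x (r : R) : 0 < r ->
  measurable_fun [set: rV] f -> (forall y, (0 <= f y)%E) ->
  (\int[@lebesgue_row R n]_y f (x + r *: y)%R =
   (r ^- n)%:E * \int[@lebesgue_row R n]_y f y)%E.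
Proof.
move=> r0 mf f0.
have rn0 : 0 <= r ^- n by rewrite invr_ge0 exprn_ge0 ?ltW.
rewrite -(ge0_integral_mscale _ _ (NngNum rn0))//.
pose phi y := x + r *: y.
have mphi : measurable_fun setT phi by exact: measurable_affine.
have phiV a b : phi @^-1` obox a b = obox (r^-1 *: (a - x)) (r^-1 *: (b - x)).
  by apply/seteqP; split=> y h i; have := h i; rewrite /phi /= !mxE !in_itv/=;
    rewrite ![r^-1 * _]mulrC ltr_pdivrMr// ltr_pdivlMr// [_ * r]mulrC;
    case/andP => h1 h2; apply/andP; split; lra.
pose m1 := [the measure _ _ of
  measure_function_pushforward__canonical__measure_function_Measure (@lebesgue_row R n) mphi].
have -> : (\int[@lebesgue_row R n]_y f (x + r *: y)%R = \int[m1]_y f y)%E.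
  by rewrite (ge0_integral_pushforward mphi).
apply: eq_measure_integral => A mA _.
apply: (measure_unique oboxes centered_box) => //.
- exact: oboxes_measurableE.
- exact: setI_closed_oboxes.
- by move=> k; eexists; [|eexists].
- exact: bigcup_centered_box.
- move=> _ [a _ [b _ <-]].
  rewrite /m1 /= /pushforward phiV lebesgue_row_obox.
  rewrite [RHS](_ : _ = ((r ^- n)%:E * lebesgue_row (obox a b))%E)// lebesgue_row_obox.
  rewrite -EFinM; congr EFin.
  rewrite -exprVn -[in X in _ ^+ X](card_ord n) -prodr_const -big_split/=; apply: eq_bigr => i _.
  rewrite !mxE maxr_pMr ?invr_ge0 ?ltW// mulr0; congr Num.max; ring.
- move=> k; rewrite /m1 /= /pushforward.
  by rewrite phiV lebesgue_row_obox ltry.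
Qed.

End rows.

(** * Dyadic Riesz kernels *)

(** The factor may be +oo, as a Riesz kernel is on the diagonal; then f = 0 has to be treated apart,
    by the convention +oo * 0 = 0. *)
Lemma zsumeZl {R : realType} (c : \bar R) (f : int -> \bar R) :
  (0 <= c)%E -> (forall k, (0 <= f k)%E) ->
  zsum (fun k => c * f k)%E = (c * zsum f)%E.
Proof.
move: c => [c| |] // c0 f0; first by rewrite zsumZl.
have [f00|/existsNP[k /eqP fk0]] := pselect (forall k, f k = 0%E).
  have -> : f = fun=> 0%E by apply/funext.
  by rewrite /zsum !esum1 ?mule0// => k _; rewrite mule0.
have fk : (0 < f k)%E by rewrite lt_neqAle eq_sym fk0 f0.
rewrite gt0_mulye; last by rewrite (lt_le_trans fk)// zsum_ge.
apply/eqP; rewrite -leye_eq (le_trans _ (zsum_ge _ k))//.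
by rewrite gt0_mulye.
Qed.

Lemma measurable_boolR {R : realType} d (T : measurableType d) (b : T -> bool) :
  measurable_fun [set: T] b -> measurable_fun [set: T] (fun x => (b x)%:R : R).
Proof.
move=> mb; rewrite (_ : (fun x => _) = (fun x => if b x then 1 else 0 : R)).
  exact: measurable_fun_ifT.
by apply/funext => x; case: (b x).
Qed.

Section riesz_kernel.
Context {R : realType} {n : nat}.
Local Notation rV := 'rV[R]_n.
Implicit Types (x y z : rV) (a b : R).

Lemma measurable_dist_lt (r : R) :
  measurable_fun [set: rV * rV] (fun p => `|p.1 - p.2| < r).
Proof.
apply: measurable_fun_ltr => //.
apply: (measurableT_comp (f := fun x : rV => `|x|)).
  by apply: row_continuous_measurable; exact: norm_continuous.
apply: measurable_rowP => i; under eq_fun do rewrite !mxE.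
apply: measurable_funB.
  exact: (measurableT_comp (measurable_coord i) measurable_fst).
exact: (measurableT_comp (measurable_coord i) measurable_snd).
Qed.

Definition scale_kernel a (k : int) x y : \bar R :=
  (dyadic k `^ (a - n%:R) * (`|x - y| < dyadic k)%R%:R)%:E.

(* Up to constants, [riesz a x y] is |x - y|^(a - n) for a < n, in the sup norm. *)
Definition riesz a x y : \bar R := zsum (fun k => scale_kernel a k x y).

Lemma scale_kernel_ge0 a k x y : (0 <= scale_kernel a k x y)%E.
Proof. by rewrite lee_fin mulr_ge0 ?powR_ge0. Qed.
Hint Resolve scale_kernel_ge0 : core.

Lemma riesz_ge0 a x y : (0 <= riesz a x y)%E.
Proof. by apply: zsum_ge0. Qed.
Hint Resolve riesz_ge0 : core.

Lemma scale_kernelC a k x y : scale_kernel a k x y = scale_kernel a k y x.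
Proof. by rewrite /scale_kernel distrC. Qed.

Lemma rieszC a x y : riesz a x y = riesz a y x.
Proof. by congr zsum; apply/funext => k; exact: scale_kernelC. Qed.

Lemma measurable_scale_kernel a k :
  measurable_fun [set: rV * rV] (fun p => scale_kernel a k p.1 p.2).
Proof.
apply/measurable_EFinP; apply: measurable_funM => //.
by apply: measurable_boolR; exact: measurable_dist_lt.
Qed.

Lemma measurable_riesz a : measurable_fun [set: rV * rV] (fun p => riesz a p.1 p.2).
Proof. by apply: measurable_zsum => // k; exact: measurable_scale_kernel. Qed.

Lemma measurable_scale_kernelr a k x :
  measurable_fun [set: rV] (scale_kernel a k x).
Proof.
exact: (measurableT_comp (measurable_scale_kernel a k) (measurable_pair1 x)).
Qed.

Lemma measurable_rieszr a x : measurable_fun [set: rV] (riesz a x).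
Proof.
exact: (measurableT_comp (measurable_riesz a) (measurable_pair1 x)).
Qed.

Lemma measurable_rieszl a y : measurable_fun [set: rV] (fun x => riesz a x y).
Proof.
by under eq_fun do rewrite rieszC; exact: measurable_rieszr.
Qed.

Lemma lebesgue_row_ball x (r : R) : 0 < r ->
  lebesgue_row [set y : rV | `|x - y| < r] = ((2 * r) ^+ n)%:E.
Proof.
move=> r0.
have -> : [set y : rV | `|x - y| < r] = obox (x - const_mx r) (x + const_mx r).
  apply/seteqP; split => y /=.
    move/(row_normP (x - y) r0) => h i; have := h i.
    by rewrite /= in_itv/= !mxE ltr_norml => /andP[h1 h2]; apply/andP; split; lra.
  move=> h; apply/(row_normP (x - y) r0) => i; have := h i.
  by rewrite /= in_itv/= !mxE ltr_norml => /andP[h1 h2]; apply/andP; split; lra.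
rewrite lebesgue_row_obox; congr EFin.
rewrite -[in X in _ ^+ X](card_ord n) -prodr_const; apply: eq_bigr => i _.
by rewrite !mxE max_r; lra.
Qed.

(** The integrand is supported in two balls around x and z: the smaller one bounds the volume, and
    the triangle inequality bounds the distance of the centers by 2^j + 2^k. *)
Lemma integral_scale_kernel2 a b j k x z :
  (\int[@lebesgue_row R n]_y (scale_kernel a j x y * scale_kernel b k y z) <=
   (dyadic j `^ (a - n%:R) * dyadic k `^ (b - n%:R) *
    (2 * Num.min (dyadic j) (dyadic k)) ^+ n *
    (`|x - z| < 2 * Num.max (dyadic j) (dyadic k))%R%:R)%:E)%E.
Proof.
set c := dyadic j `^ (a - n%:R) * dyadic k `^ (b - n%:R).
have c0 : 0 <= c by rewrite mulr_ge0 ?powR_ge0.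
set mn := Num.min _ _; set mx := Num.max _ _.
have mn0 : 0 < mn by rewrite lt_min !dyadic_gt0.
have [xz|xz] := ltP `|x - z| (2 * mx); last first.
  rewrite mulr0 (eq_integral (fun=> 0%E)) ?integral0// => y _.
  rewrite /scale_kernel -EFinM; congr EFin.
  have [xy|_] := boolP (`|x - y| < dyadic j); last first.
    by rewrite [X in X * _]mulr0 mul0r.
  have [yz|_] := boolP (`|y - z| < dyadic k); last first.
    by rewrite [X in _ * X]mulr0 mulr0.
  suff : `|x - z| < 2 * mx by rewrite ltNge xz.
  rewrite (le_lt_trans (ler_distD y _ _))// mulr2n mulrDl mul1r.
  by rewrite ltrD// lt_max ?xy ?yz// orbT.
rewrite mulr1.
have key w : (\int[@lebesgue_row R n]_y (c * (`|w - y| < mn)%R%:R)%:E =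
    (c * (2 * mn) ^+ n)%:E)%E.
  have mb : measurable_fun [set: rV] (fun y => (`|w - y| < mn)%R%:R%:E : \bar R).
    apply/measurable_EFinP/measurable_boolR.
    exact: (measurableT_comp (measurable_dist_lt mn) (measurable_pair1 w)).
  under eq_integral do rewrite EFinM.
  rewrite ge0_integralZl//= [RHS]EFinM; congr mule.
  have mB : measurable [set y : rV | `|w - y| < mn].
    rewrite -[X in measurable X]setTI.
    by apply: (measurableT_comp (measurable_dist_lt mn) (measurable_pair1 w)).
  have := integral_indic (@lebesgue_row R n) measurableT mB.
  rewrite setIT [RHS]lebesgue_row_ball// => <-; apply: eq_integral => y _.
  rewrite indicE; congr ((nat_of_bool _)%:R%:E).
  by apply/idP/idP; rewrite inE.
have mcomp w : measurable_fun [set: rV] (fun y => (c * (`|w - y| < mn)%R%:R)%:E).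
  apply/measurable_EFinP/measurable_funM => //; apply: measurable_boolR.
  exact: (measurableT_comp (measurable_dist_lt mn) (measurable_pair1 w)).
have mprod : measurable_fun [set: rV] (fun y => scale_kernel a j x y * scale_kernel b k y z)%E.
  apply: emeasurable_funM; first exact: measurable_scale_kernelr.
  by under eq_fun do rewrite scale_kernelC; exact: measurable_scale_kernelr.
have /orP[jk|jk] := le_total (dyadic j : R) (dyadic k).
  rewrite -(key x); apply: ge0_le_integral => //.
    by move=> y _; rewrite mule_ge0.
  move=> y _; rewrite /scale_kernel -EFinM lee_fin mulrACA -/c ler_wpM2l//.
  rewrite /mn min_l//.
  by case: (`|x - y| < _); case: (`|y - z| < _); rewrite ?mulr1 ?mulr0 ?mul0r ?mul1r ?lexx ?ler01.
rewrite -(key z); apply: ge0_le_integral => //.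
  by move=> y _; rewrite mule_ge0.
move=> y _; rewrite /scale_kernel -EFinM lee_fin mulrACA -/c ler_wpM2l//.
rewrite /mn min_r// [`|z - y|]distrC.
by case: (`|x - y| < _); case: (`|y - z| < _); rewrite ?mulr1 ?mulr0 ?mul0r ?mul1r ?lexx ?ler01.
Qed.

End riesz_kernel.
#[export] Hint Resolve scale_kernel_ge0 riesz_ge0 : core.

Lemma le_of_eq d (T : porderType d) (x y : T) : x = y -> (x <= y)%O.
Proof. by move=> ->. Qed.

(** * Composition of Riesz kernels *)

Section riesz_compose.
Context {R : realType} {n : nat}.
Local Notation rV := 'rV[R]_n.
Implicit Types (x y z : rV) (a b : R).

(** Absorbs the doubling of the radius that the triangle inequality causes into a shift of the
    scale. *)
Lemma scale_kernel_succ a k x z :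
  (dyadic k `^ (a - n%:R) * (`|x - z| < dyadic (k + 1))%R%:R)%:E =
  ((2 `^ (n%:R - a))%:E * scale_kernel a (k + 1)%R x z)%E.
Proof.
rewrite /scale_kernel -EFinM mulrA; congr (_ * _)%:E.
rewrite dyadicS powRM ?(ltW (dyadic_gt0 _))// mulrA -powRD ?pnatr_eq0 ?implybT//.
by rewrite addrA subrK subrr powRr0 mul1r.
Qed.

(** The sum 1 + 2^(-b) + 2^(-2b) + ... for b > 0. *)
Definition geo (b : R) : R := (1 - 2 `^ (- b))^-1.

Lemma geo_ge0 b : 0 < b -> 0 <= geo b.
Proof.
move=> b0; rewrite invr_ge0 subr_ge0 powRN invf_le1 ?powR_gt0//.
by rewrite -{1}(powRr0 (2 : R)) ler_powR ?ler1n ?ltW.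
Qed.

Let weight b j k : R := dyadic j `^ b * (dyadic j <= dyadic k :> R)%R%:R.

Let weight_ge0 b j k : 0 <= weight b j k.
Proof. by rewrite mulr_ge0 ?powR_ge0. Qed.

Let term a b k x z : R :=
  dyadic k `^ (a + b - n%:R) * (`|x - z| < dyadic (k + 1))%R%:R.

(** Contribution of the pairs of scales j <= k in which the kernel of order a has the smaller
    radius: the volume 2^(jn) has turned 2^(j(a-n)) into 2^(ja), and the sum over j <= k is at most
    [geo a] times 2^(ka). *)
Let half a b (ab : 0 < a) x z :
  (zsum (fun k => zsum (fun j =>
    (dyadic k `^ (b - n%:R) * (`|x - z| < dyadic (k + 1))%R%:R)%:E * (weight a j k)%:E))
   <= (geo a * 2 `^ (n%:R - (a + b)))%:E * riesz (a + b) x z)%E.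
Proof.
have -> : ((geo a * 2 `^ (n%:R - (a + b)))%:E * riesz (a + b) x z =
  zsum (fun k => (geo a)%:E * (term a b k x z)%:E))%E.
  rewrite EFinM -muleA zsumZl ?geo_ge0//; last first.
    by move=> k; rewrite lee_fin mulr_ge0 ?powR_ge0.
  congr (_ * _)%E; rewrite -zsumZl ?powR_ge0//.
  rewrite -(zsum_shift _ 1).
  by congr zsum; apply/funext => k; rewrite /term scale_kernel_succ.
apply: le_zsum => k; rewrite zsumeZl; last 2 first.
- by rewrite lee_fin mulr_ge0 ?powR_ge0.
- by move=> j; rewrite lee_fin.
have := @dyadic_le_sum R a (dyadic k) ab (dyadic_gt0 _).
move=> /(lee_wpmul2l _) h; apply: le_trans (h _ _) _.
  by rewrite lee_fin mulr_ge0 ?powR_ge0.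
rewrite -!EFinM lee_fin /term -/(geo a).
rewrite -[a + b - _]addrA (@powRD _ _ a) ?(gt_eqF (dyadic_gt0 _)) ?implybT//.
by apply: le_of_eq; rewrite /geo; ring.
Qed.

Lemma riesz_compose a b x z : 0 < a -> 0 < b ->
  (\int[@lebesgue_row R n]_y (riesz a x y * riesz b y z) <=
   (2 ^+ n * (geo a + geo b) * 2 `^ (n%:R - (a + b)))%:E * riesz (a + b) x z)%E.
Proof.
move=> a0 b0.
have mk j k : measurable_fun [set: rV]
    (fun y => scale_kernel a j x y * scale_kernel b k y z)%E.
  apply: emeasurable_funM; first exact: measurable_scale_kernelr.
  by under eq_fun do rewrite scale_kernelC; exact: measurable_scale_kernelr.
have k0 j k y : (0 <= scale_kernel a j x y * scale_kernel b k y z)%E by rewrite mule_ge0.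
have -> : (\int[@lebesgue_row R n]_y (riesz a x y * riesz b y z) =
  zsum (fun k => zsum (fun j => \int[@lebesgue_row R n]_y
     (scale_kernel a j x y * scale_kernel b k y z))))%E.
  rewrite zsum_interchange; last by move=> *; apply: integral_ge0 => *.
  transitivity (zsum (fun j => \int[@lebesgue_row R n]_y
      zsum (fun k => scale_kernel a j x y * scale_kernel b k y z)))%E; last first.
    by congr zsum; apply/funext => j; rewrite integral_zsum.
  rewrite -integral_zsum.
  - apply: eq_integral => y _; rewrite muleC -zsumeZl//; congr zsum.
    by apply/funext => j; rewrite zsumeZl// muleC.
  - by move=> j; exact: measurable_zsum.
  - by move=> j y; exact: zsum_ge0.
pose F a b k j := ((dyadic k `^ (b - n%:R) * (`|x - z| < dyadic (k + 1))%R%:R)%:E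
   * (weight a j k)%:E)%E.
have F0 a' b' k j : (0 <= F a' b' k j)%E by rewrite mule_ge0// lee_fin mulr_ge0 ?powR_ge0.
(* The pairs of scales are divided according to which radius is smaller; the diagonal j = k is
   counted in both halves, which is harmless for an upper bound. *)
apply: (@le_trans _ _ ((2 ^+ n)%:E * (zsum (fun k => zsum (F a b k)) +
    zsum (fun j => zsum (F b a j))))%E).
  rewrite [X in (_ + X)%E]zsum_interchange// -zsumD//; last 2 first.
  - by move=> k; exact: zsum_ge0.
  - by move=> k; exact: zsum_ge0.
  rewrite -zsumZl//; last by move=> k; rewrite adde_ge0// zsum_ge0.
  apply: le_zsum => k; rewrite -zsumD// -zsumZl//; last by move=> j; rewrite adde_ge0.
  apply: le_zsum => j; apply: le_trans (integral_scale_kernel2 _ _ _ _ _ _) _.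
  rewrite /F /= -!EFinM lee_fin /weight !dyadicS exprMn.
  have pdj (c : R) : dyadic j `^ (c - n%:R) * dyadic j ^+ n = dyadic j `^ c.
    by rewrite -powR_mulrn ?(ltW (dyadic_gt0 _))// -powRD ?subrK// (gt_eqF (dyadic_gt0 _)) implybT.
  have pdk (c : R) : dyadic k `^ (c - n%:R) * dyadic k ^+ n = dyadic k `^ c.
    by rewrite -powR_mulrn ?(ltW (dyadic_gt0 _))// -powRD ?subrK// (gt_eqF (dyadic_gt0 _)) implybT.
  have /orP[jk|kj] := le_total (dyadic j : R) (dyadic k).
    rewrite min_l// max_r// jk -(pdj a).
    rewrite -[leLHS]addr0 mulrDr lerD//; last by rewrite !mulr_ge0 ?powR_ge0.
    apply: le_of_eq; rewrite /= mulr1.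
    by move: (dyadic j `^ _) (dyadic k `^ _) (_ ^+ n) (_ ^+ n) => *; ring.
  rewrite min_r// max_l// kj -(pdk b).
  rewrite -[leLHS]add0r mulrDr lerD//; first by rewrite !mulr_ge0 ?powR_ge0.
  apply: le_of_eq; rewrite /= mulr1.
  by move: (dyadic j `^ _) (dyadic k `^ _) (_ ^+ n) (_ ^+ n) => *; ring.
rewrite -!mulrA EFinM -muleA lee_wpmul2l ?lee_fin ?exprn_ge0//.
rewrite mulrDl EFinD ge0_muleDl ?lee_fin ?mulr_ge0 ?geo_ge0 ?powR_ge0//.
apply: leeD; first exact: half.
by rewrite [a + b]addrC; exact: half.
Qed.

End riesz_compose.

(** * Differential calculus and the potential estimate *)

Section c1.
Context {R : realType} {n : nat}.
Local Notation rV := 'rV[R]_n.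
Implicit Types (x y v : rV) (u : rV -> R).

Lemma quotient_line u x v (s : R) :
  (fun h : R => h^-1 *:
    (((fun t : R => u (x + t *: v)) \o shift s) (h *: (1 : R)) - u (x + s *: v)))
  = (fun h : R => h^-1 *: ((u \o shift (x + s *: v)) (h *: v) - u (x + s *: v))).
Proof.
apply/funext => h /=; congr (_ *: (u _ - _)).
by rewrite scalerDl addrCA /GRing.scale /= mulr1.
Qed.

Lemma is_derive_line u x v (s : R) : derivable u (x + s *: v) v ->
  is_derive s (1 : R) (fun t : R => u (x + t *: v)) ('D_v u (x + s *: v)).
Proof.
move=> ud; split; first by rewrite /derivable quotient_line.
by rewrite /derive quotient_line.
Qed.

Lemma le_norm_delta (i : 'I_n) : `|unit_vector R i| <= 1.
Proof.
rewrite [`|_|]mx_normrE; apply/bigmax_leP; split => // -[j k] _ /=.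
by rewrite mxE; case: (_ && _); rewrite ?normr1 ?normr0.
Qed.

Lemma partial_increment u i y (t c e : R) :
  (forall x, derivable u x (unit_vector R i)) ->
  (forall s, `|s| <= `|t| -> `|partial i u (y + s *: unit_vector R i) - c| <= e) ->
  `|u (y + t *: unit_vector R i) - u y - c * t| <= e * `|t|.
Proof.
move=> ud ue.
pose f (s : R) := u (y + s *: unit_vector R i).
pose df (s : R) := partial i u (y + s *: unit_vector R i).
have fd s : is_derive s (1 : R) f (df s) by exact: is_derive_line.
have fc : continuous f.
  by move=> s; apply/differentiable_continuous/derivable1_diffP; case: (fd s).
have [s st E] : exists2 s, `|s| <= `|t| & f t - f 0 = df s * t.
  have [t0|t0] := leP 0 t.
    have [s] := MVT_segment t0 (fun s _ => fd s) (continuous_subspaceT fc).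
    rewrite in_itv/= => /andP[s0 st] ->; exists s; last by rewrite subr0.
    by rewrite !ger0_norm.
  have [s] := MVT_segment (ltW t0) (fun s _ => fd s) (continuous_subspaceT fc).
  rewrite in_itv/= => /andP[ts s0] E; exists s.
    by rewrite !ler0_norm ?lerN2// ltW.
  by rewrite -opprB E; ring.
move: E; rewrite /f scale0r addr0 => ->.
by rewrite -mulrBl normrM ler_wpM2r// ue.
Qed.

(** The passage from x to x + h v is made one coordinate at a time. The bound S on the l^1 norm
    stays fixed during the induction and keeps all intermediate points in the region where the
    partial derivatives are controlled. *)
Lemma c1_increment u x v (h e S : R) (c : 'I_n -> R) (s : seq 'I_n) :
  (forall i y, derivable u y (unit_vector R i)) ->
  (forall i y, `|y - x| <= `|h| * S -> `|partial i u y - c i| <= e) ->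
  \sum_(j <- s) `|v ord0 j| <= S ->
  `|u (x + h *: \sum_(j <- s) v ord0 j *: unit_vector R j) - u x
    - h * \sum_(j <- s) v ord0 j * c j| <= e * (`|h| * \sum_(j <- s) `|v ord0 j|).
Proof.
move=> ud ue; elim: s => [|i s IH].
  by rewrite !big_nil scaler0 addr0 !mulr0 !subrr normr0.
rewrite !big_cons; set w := \sum_(j <- s) v ord0 j *: _ in IH *.
set T := \sum_(j <- s) `|v ord0 j| in IH *.
move=> TS; have {}IH := IH (le_trans _ TS).
have wle : `|w| <= T.
  apply: le_trans (ler_norm_sum _ _ _) _; apply: ler_sum => j _.
  by rewrite normrZ ler_piMr// le_norm_delta.
have := @partial_increment u i (x + h *: w) (h * v ord0 i) (c i) e (ud i).
rewrite scalerDr scalerA [_ + h *: w in X in _ -> X]addrC [x + (_ + _)]addrA.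
set A := u (x + h *: w + _) => Ale.
have {}Ale : `|A - u (x + h *: w) - c i * (h * v ord0 i)| <= e * `|h * v ord0 i|.
  apply: Ale => t tle; apply: ue.
  rewrite addrC -addrA addKr (le_trans (ler_normD _ _))// !normrZ.
  apply: le_trans (ler_wpM2l (normr_ge0 h) TS).
  rewrite [leRHS]mulrDr addrC lerD//; last by rewrite ler_wpM2l.
  by rewrite -normrM (le_trans _ tle)// ler_piMr// le_norm_delta.
have {}IH : `|u (x + h *: w) - u x - h * \sum_(j <- s) v ord0 j * c j| <= e * (`|h| * T).
  by apply: IH; rewrite lerDr.
rewrite [leRHS](_ : _ = e * `|h * v ord0 i| + e * (`|h| * T)).
  apply: le_trans (lerD Ale IH); apply: le_trans (ler_normD _ _).
  by rewrite le_eqVlt; apply/orP; left; apply/eqP; congr `|_|; ring.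
by rewrite normrM; ring.
Qed.

(** [smooth] only speaks of partial derivatives, whereas the rays below run in arbitrary
    directions. *)
Lemma c1_derive u x v : (forall i y, derivable u y (unit_vector R i)) ->
  (forall i, continuous (partial i u)) ->
  is_derive x v u (\sum_i v ord0 i * partial i u x).
Proof.
move=> ud uc; set l := \sum_i _.
suff h : h^-1 *: ((u \o shift x) (h *: v) - u x) @[h --> 0^'] --> l.
  by split; [apply/cvg_ex; exists l|exact/cvg_lim].
apply/cvgrPdist_le => e e0 /=.
set S := \sum_(j < n) `|v ord0 j|.
have S0 : 0 <= S by apply: sumr_ge0.
have S1 : 0 < S + 1 by rewrite ltr_wpDl.
pose e' := e / (S + 1).
have e'0 : 0 < e' by rewrite divr_gt0.
have near_i i : \forall y \near x, `|partial i u (y : rV) - partial i u x| <= e'.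
  have /cvgrPdist_le/(_ _ e'0) := uc i x.
  by apply: filterS => y; rewrite distrC.
have : \forall y \near x, forall i : 'I_n, `|partial i u (y : rV) - partial i u x| <= e'.
  exact: filter_forall near_i.
move=> /nbhs_ballP[d /= d0 dB].
have dS : 0 < d / (S + 1) by rewrite divr_gt0.
near=> h.
have h0 : h != 0 by near: h; exact: nbhs_dnbhs_neq.
have hd : `|h| < d / (S + 1).
  by near: h; apply: dnbhs0_lt.
have hS : `|h| * S < d.
  apply: le_lt_trans (_ : `|h| * (S + 1) < _); first by rewrite ler_wpM2l// lerDl.
  by rewrite -ltr_pdivlMr.
have := @c1_increment u x v h e' S (fun i => partial i u x) (index_enum _) ud.
have vE : \sum_j v ord0 j *: unit_vector R j = v by rewrite [RHS]row_sum_delta.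
have near_x i y : `|y - x| <= `|h| * S -> `|partial i u y - partial i u x| <= e'.
  move=> yx; apply: dB; rewrite -ball_normE /ball_/= distrC.
  exact: le_lt_trans hS.
rewrite vE => /(_ near_x (lexx _)); rewrite -/S -/l /= [x + _]addrC => B.
have -> : l - h^-1 *: (u (h *: v + x) - u x) =
    - (h^-1 * (u (h *: v + x) - u x - h * l)).
  by rewrite /GRing.scale/=; field.
rewrite normrN normrM normfV -ler_pdivlMl ?invr_gt0 ?normr_gt0// invrK.
apply: le_trans B _; rewrite mulrCA ler_wpM2l// /e'.
by rewrite -mulrA ler_piMr ?(ltW e0)// mulrC ler_pdivrMr// mul1r lerDl.
Unshelve. all: by end_near. Qed.

End c1.

(** The integral of a non-negative function is a supremum over the simple functions below it, hence
    monotone for arbitrary functions. This covers [otelbaev_q], about whose measurability nothing is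
    shown. *)
Lemma le_ge0_integral d (T : measurableType d) (R : realType)
    (mu : {measure set T -> \bar R}) (D : set T) (f g : T -> \bar R) :
  (forall x, D x -> (0 <= f x)%E) -> (forall x, D x -> (f x <= g x)%E) ->
  (\int[mu]_(x in D) f x <= \int[mu]_(x in D) g x)%E.
Proof.
move=> f0 fg; rewrite !(integral_mkcond D).
have f0' x : (0 <= (f \_ D) x)%E by apply: erestrict_ge0.
have fg' x : ((f \_ D) x <= (g \_ D) x)%E by apply: lee_restrict.
rewrite !ge0_integralTE//; last by move=> x; exact: le_trans (fg' x).
apply: le_ereal_sup => _ [h hf <-]; exists h => // x.
exact: le_trans (hf x) (fg' x).
Qed.

Lemma continuous_sumR {R : realType} (T : topologicalType) (I : Type) (s : seq I)
    (f : I -> T -> R) :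
  (forall i, continuous (f i)) -> continuous (fun x => \sum_(i <- s) f i x).
Proof.
move=> fc x; elim: s => [|i s IH].
  by under eq_fun do rewrite big_nil; rewrite ?big_nil; exact: cvg_cst.
by under eq_fun do rewrite big_cons; rewrite ?big_cons; apply: cvgD => //; exact: fc.
Qed.

(** * From rays to the Riesz potential of order 1 *)

Section representation.
Context {R : realType} {n : nat}.
Local Notation rV := 'rV[R]_n.
Implicit Types (x y v : rV) (u : rV -> R).

Definition grad_sum u y : R := \sum_i `|partial i u y|.

Lemma grad_sum_ge0 u y : 0 <= grad_sum u y.
Proof. exact: sumr_ge0. Qed.

Variable u : rV -> R.
Hypothesis ud : forall i y, derivable u y (unit_vector R i).
Hypothesis uc : forall i, continuous (partial i u).
Hypothesis u_supp : exists M, forall y, M <= `|y| -> u y = 0.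

Let cgrad : continuous (grad_sum u).
Proof.
apply: continuous_sumR => i y; apply: continuous_comp; first exact: uc.
exact: norm_continuous.
Qed.

Lemma measurable_grad_sum : measurable_fun [set: rV] (grad_sum u).
Proof. exact: row_continuous_measurable. Qed.

(** The fundamental theorem of calculus from x to a point of the ray where u vanishes; the
    coordinates of v are at most 1 in absolute value. *)
Lemma ray_bound x v : v != 0 -> `|v| <= 1 ->
  (`|u x|%:E <= \int[lebesgue_measure]_(r in `]0%R, +oo[) (grad_sum u (x + r *: v))%:E)%E.
Proof.
move=> v0 v1; have [M uM] := u_supp.
have nv0 : 0 < `|v| by rewrite normr_gt0.
(* Chosen so that T |v| - |x| >= M; the maximum with 0 and the final 1 keep T positive whatever the
   sign of M. *)
pose T := (Num.max M 0 + `|x|) / `|v| + 1.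
have T0 : 0 < T by rewrite ltr_wpDl// divr_ge0// addr_ge0// le_max lexx orbT.
have uT : u (x + T *: v) = 0.
  apply: uM; have : `|T *: v| <= `|x + T *: v| + `|x|.
    by rewrite -[X in `|X| <= _](addKr x) addrC (le_trans (ler_normB _ _)).
  rewrite normrZ gtr0_norm// /T mulrDl divfK ?gt_eqF// mul1r => h.
  have : M <= Num.max M 0 by rewrite le_max lexx.
  by move: nv0 h; lra.
pose g r := u (x + r *: v).
pose dg r := \sum_i v ord0 i * partial i u (x + r *: v).
have gd r : is_derive r (1 : R) g (dg r).
  have [dv dE] := c1_derive (x + r *: v) v ud uc.
  by rewrite /dg -dE; exact: is_derive_line.
have gc : continuous g.
  by move=> s; apply/differentiable_continuous/derivable1_diffP; case: (gd s).
have linec : continuous (fun r : R => x + r *: v).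
  by move=> r; apply: cvgD; [exact: cvg_cst|apply: cvgZr_tmp; exact: cvg_id].
have dgc : continuous dg.
  apply: continuous_sumR => i r; apply: cvgM; first exact: cvg_cst.
  by apply: continuous_comp; [exact: linec|exact: uc].
have := @continuous_FTC2 R dg g 0 T T0.
rewrite /g uT scale0r addr0 sub0e => FTC.
have {}FTC : (\int[lebesgue_measure]_(r in `[0%R, T]) (dg r)%:E = - (u x)%:E)%E.
  rewrite FTC//.
  - exact: continuous_subspaceT.
  - split; first by move=> r _; case: (gd r).
    + by apply: cvg_at_right_filter; exact: gc.
    + by apply: cvg_at_left_filter; exact: gc.
  - by move=> r _; rewrite derive1E; case: (gd r).
have mdg (I : set R) : measurable_fun I (EFin \o dg).
  apply/measurable_EFinP; apply: measurable_funTS.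
  exact: continuous_measurable_fun.
have := le_abse_integral lebesgue_measure (measurable_itv `[0%R, T]) (mdg _).
rewrite FTC abseN /= => /le_trans; apply.
rewrite -integral_itv_obnd_cbnd; last first.
  apply/measurable_EFinP; apply: measurable_funTS; apply: continuous_measurable_fun => r.
  by apply: (continuous_comp (dgc r)); exact: norm_continuous.
apply: (@le_trans _ _ (\int[lebesgue_measure]_(r in `]0%R, T]) (grad_sum u (x + r *: v))%:E)%E).
  apply: le_ge0_integral => // r _; rewrite lee_fin.
  apply: le_trans (ler_norm_sum _ _ _) _; apply: ler_sum => i _.
  rewrite normrM ler_piMl// (le_trans _ v1)// [leRHS]mx_normrE.
  by apply: le_trans (le_bigmax _ _ (ord0, i)).
apply: ge0_subset_integral => //.
- apply/measurable_EFinP; apply: measurable_funTS; apply: continuous_measurable_fun.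
  by move=> r; apply: (@continuous_comp _ _ _ (fun r : R => x + r *: v) (grad_sum u));
    [exact: linec|exact: cgrad].
- by move=> r _; rewrite lee_fin grad_sum_ge0.
- by move=> r /=; rewrite !in_itv/= => /andP[-> _].
Qed.

End representation.

Section representation2.
Context {R : realType} {n : nat}.
Local Notation rV := 'rV[R]_n.
Implicit Types (x y v : rV) (u : rV -> R).
Local Notation leb := (@lebesgue_row R n).

(** The set of directions: it has volume 1, and its points satisfy |v| < 1 and, for n > 0, v !=
    0. *)
Let unit_cube : set rV := obox 0 (const_mx 1).

(** Substitution y = x + r v: since |v| < 1, the point y lies within r < 2^(k+1) of x, and the
    Jacobian r^(-n) is at most 2^(-kn). *)
Lemma integral_cube_affine (F : rV -> R) x (r : R) (k : int) :
  (forall y, 0 <= F y) -> measurable_fun [set: rV] F -> dyadic k <= r < dyadic (k + 1) ->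
  (\int[leb]_v (\1_unit_cube v * F (x + r *: v)%R)%:E <=
   (dyadic k ^- n)%:E *
     \int[leb]_y ((`|x - y| < dyadic (k + 1))%R%:R * F y)%:E)%E.
Proof.
move=> F0 mF /andP[kr rk]; have r0 : 0 < r by exact: lt_le_trans (dyadic_gt0 k) kr.
have mG (t : R) : measurable_fun [set: rV] (fun y => ((`|x - y| < t)%R%:R * F y)%:E).
  apply/measurable_EFinP/measurable_funM => //; apply: measurable_boolR.
  exact: (measurableT_comp (measurable_dist_lt t) (measurable_pair1 x)).
pose G y := ((`|x - y| < r)%R%:R * F y)%:E.
have G0 y : (0 <= G y)%E by rewrite lee_fin mulr_ge0.
apply: (@le_trans _ _ (\int[leb]_v G (x + r *: v)%R)%E).
  apply: le_ge0_integral => v _; first by rewrite lee_fin mulr_ge0 ?indicE.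
  rewrite lee_fin ler_wpM2r// indicE; case: (boolP (v \in unit_cube)) => // /[!inE] vU.
  rewrite opprD addrA subrr sub0r normrN normrZ gtr0_norm//.
  rewrite -[X in _ < X]mulr1 ltr_pM2l// (_ : (_ < 1) = true)//.
  apply/(row_normP v ltr01) => i; have := vU i.
  by rewrite /= in_itv/= !mxE => /andP[v0 v1]; rewrite gtr0_norm.
rewrite (integral_affine x r0 (mG r) G0).
apply: lee_pmul; rewrite ?lee_fin ?invr_ge0 ?exprn_ge0 ?dyadic_ge0 ?(ltW r0)//.
- by apply: integral_ge0 => y _; exact: G0.
- rewrite lef_pV2 ?posrE ?exprn_gt0 ?dyadic_gt0//.
  by apply: lerXn2r; rewrite ?nnegrE ?(ltW r0) ?(ltW (dyadic_gt0 _)).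
- apply: le_ge0_integral => y _; first exact: G0.
  rewrite lee_fin ler_wpM2r// ler_nat.
  by case: ltP => // xr; rewrite (lt_trans xr).
Qed.

Lemma lebesgue_unit_cube : leb unit_cube = 1%E.
Proof.
rewrite lebesgue_row_obox big1// => i _.
by rewrite !mxE subr0 max_r.
Qed.

Lemma measurable_unit_cube : measurable unit_cube.
Proof. by apply: row_open_measurable; exact: open_obox. Qed.

Lemma measurable_ray x :
  measurable_fun [set: rV * measurableTypeR R] (fun p => x + p.2 *: p.1).
Proof.
apply: measurable_rowP => i; under eq_fun do rewrite !mxE.
apply: measurable_funD => //; apply: measurable_funM => //.
exact: (measurableT_comp (measurable_coord i) measurable_fst).
Qed.

(** The ray bound is averaged over v in the unit cube, the integrals over v and r are exchanged, and
    r is divided into dyadic ranges, one for each scale of the kernel. The constant 2^(n-1) is the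
    price of replacing radius 2^(k+1) by the next scale. *)
Lemma riesz_bound u x : (0 < n)%N ->
  (forall i y, derivable u y (unit_vector R i)) ->
  (forall i, continuous (partial i u)) ->
  (exists M, forall y, M <= `|y| -> u y = 0) ->
  (`|u x|%:E <= (2 `^ (n%:R - 1))%:E *
    \int[leb]_y (riesz 1 x y * (grad_sum u y)%:E))%E.
Proof.
move=> n0 ud uc us; set F := grad_sum u.
have F0 y : 0 <= F y := grad_sum_ge0 u y.
have mF : measurable_fun [set: rV] F := measurable_grad_sum uc.
pose Phi (p : rV * measurableTypeR R) : \bar R :=
  (\1_unit_cube p.1 * (0 < p.2)%R%:R * F (x + p.2 *: p.1))%:E.
have Phi0 p : (0 <= Phi p)%E by rewrite lee_fin !mulr_ge0 ?indicE.
have mPhi : measurable_fun setT Phi.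
  apply/measurable_EFinP; apply: measurable_funM.
    apply: measurable_funM.
      apply: (measurableT_comp _ measurable_fst).
      by apply: measurable_indic; exact: measurable_unit_cube.
    by apply: measurable_boolR; apply: measurable_fun_ltr.
  exact: (measurableT_comp mF (measurable_ray x)).
pose H (k : int) := ((dyadic k ^- n)%:E *
     \int[leb]_y ((`|x - y| < dyadic (k + 1))%R%:R * F y)%:E)%E.
have mG (t : R) : measurable_fun [set: rV] (fun y => ((`|x - y| < t)%R%:R * F y)%:E).
  apply/measurable_EFinP/measurable_funM => //; apply: measurable_boolR.
  exact: (measurableT_comp (measurable_dist_lt t) (measurable_pair1 x)).
have H0 k : (0 <= H k)%E.
  rewrite mule_ge0 ?lee_fin ?invr_ge0 ?exprn_ge0 ?dyadic_ge0//.
  by apply: integral_ge0 => y _; rewrite lee_fin mulr_ge0.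
apply: (@le_trans _ _ (\int[leb]_v \int[lebesgue_measure]_r Phi (v, r))%E).
  have -> : (`|u x|%:E = \int[leb]_(v in unit_cube) (`|u x|%:E))%E.
    have := integral_cst leb measurable_unit_cube `|u x|%:E.
    move=> ->; rewrite -[LHS]mule1; congr mule.
    exact/esym/lebesgue_unit_cube.
  rewrite integral_mkcond; apply: le_ge0_integral => v _; first by apply: erestrict_ge0.
  rewrite patchE; case: ifPn => vU; last by apply: integral_ge0.
  have {}vU := set_mem vU.
  have v1 : `|v| <= 1.
    apply: ltW; apply/(row_normP v ltr01) => i; have := vU i.
    by rewrite /= in_itv/= !mxE => /andP[h1 h2]; rewrite gtr0_norm.
  have vn0 : v != 0.
    apply/eqP => v0; have := vU (Ordinal n0).
    by rewrite v0 /= in_itv/= !mxE ltxx.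
  apply: le_trans (ray_bound ud uc us x vn0 v1) _.
  rewrite integral_mkcond; apply: le_ge0_integral => r _.
    by apply: erestrict_ge0 => ? _; rewrite lee_fin.
  rewrite patchE /Phi /= indicE (mem_set vU) mul1r.
  case: ifPn => [|_]; last by rewrite lee_fin mulr_ge0.
  by rewrite inE /= in_itv/= andbT => -> /=; rewrite mul1r.
rewrite (fubini_tonelli Phi)//.
apply: (@le_trans _ _ (\int[lebesgue_measure]_r
    zsum (fun k => (dyadic k <= r < dyadic (k + 1))%R%:R%:E * H k)))%E.
  apply: le_ge0_integral => r _; first exact: integral_ge0.
  have [r0|r0] := leP r 0.
    rewrite (eq_integral (fun=> 0%E)) ?integral0; last first.
      by move=> v _; rewrite /Phi /= ltNge r0 mulr0 mul0r.
    by apply: zsum_ge0 => k; rewrite mule_ge0.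
  have [k kr] := dyadic_floor r0.
  apply: le_trans (zsum_ge _ k); rewrite kr mul1e.
  apply: le_trans (integral_cube_affine x F0 mF kr).
  by under eq_integral do rewrite /Phi /= r0 mulr1.
rewrite integral_zsum; last 2 first.
- move=> k; apply: emeasurable_funM => //.
  apply/measurable_EFinP; apply: measurable_boolR.
  by apply: measurable_and; [exact: measurable_fun_ler|exact: measurable_fun_ltr].
- by move=> k r; rewrite mule_ge0.
rewrite -ge0_integralZl//; last 2 first.
- apply: emeasurable_funM; first exact: measurable_rieszr.
  exact/measurable_EFinP.
- by move=> y _; rewrite mule_ge0// lee_fin.
have RE y : ((2 `^ (n%:R - 1))%:E * (riesz 1 x y * (F y)%:E) =
    zsum (fun k => (F y)%:E * ((2 `^ (n%:R - 1))%:E * scale_kernel 1 (k + 1)%R x y)))%E.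
  rewrite muleA muleC /riesz -zsumZl ?powR_ge0// -zsumeZl ?lee_fin//.
    by rewrite -(zsum_shift _ 1).
  by move=> k; rewrite mule_ge0 ?scale_kernel_ge0 ?lee_fin ?powR_ge0.
under [leRHS]eq_integral do rewrite RE.
rewrite /= integral_zsum; last 2 first.
- move=> k; apply: emeasurable_funM; first exact/measurable_EFinP.
  by apply: emeasurable_funM => //; exact: measurable_scale_kernelr.
- by move=> k y; rewrite !mule_ge0 ?scale_kernel_ge0 ?lee_fin ?powR_ge0.
apply: le_zsum => k.
(* The range of r has length 2^(k+1) - 2^k = 2^k; together with 2^(-kn) this is the weight
   2^(k(1-n)) of the kernel of order 1. *)
have -> : (\int[lebesgue_measure]_r ((dyadic k <= r < dyadic (k + 1))%R%:R%:E * H k) =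
  (dyadic k)%:E * H k)%E.
  rewrite ge0_integralZr//; last first.
    apply/measurable_EFinP; apply: measurable_boolR.
    by apply: measurable_and; [exact: measurable_fun_ler|exact: measurable_fun_ltr].
  congr (_ * _)%E.
  transitivity (lebesgue_measure (`[dyadic k, dyadic (k + 1)[%classic : set R)).
    have := @integral_indic _ _ _ (@lebesgue_measure R) setT measurableT _
      (measurable_itv `[dyadic k, dyadic (k + 1)[).
    rewrite setIT => <-; apply: eq_integral => r _.
    rewrite indicE; congr ((nat_of_bool _)%:R%:E).
    by apply/idP/idP; rewrite ?inE /= in_itv.
  rewrite lebesgue_measure_itv /= lte_fin.
  have -> : (dyadic k : R) < dyadic (k + 1) by rewrite dyadicS ltr_pMl ?ltr1n ?dyadic_gt0.
  by rewrite -EFinB dyadicS mulr2n mulrDl mul1r addrK.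
rewrite /H muleA -EFinM -ge0_integralZl//; last 2 first.
- by move=> y _; rewrite lee_fin mulr_ge0.
- by rewrite lee_fin mulr_ge0 ?invr_ge0 ?exprn_ge0 ?dyadic_ge0.
apply: le_ge0_integral => y _.
  by rewrite mule_ge0 ?lee_fin ?mulr_ge0 ?invr_ge0 ?exprn_ge0 ?dyadic_ge0.
rewrite -scale_kernel_succ -!EFinM lee_fin; apply: le_of_eq.
rewrite powRD ?(gt_eqF (dyadic_gt0 _)) ?implybT// powRr1 ?(ltW (dyadic_gt0 _))//.
rewrite powRN powR_mulrn ?(ltW (dyadic_gt0 _))//; ring.
Qed.

End representation2.

(** * Iteration to potentials of higher order *)

Section iterated.
Context {R : realType} {n : nat}.
Local Notation rV := 'rV[R]_n.
Implicit Types (x y z : rV) (u : rV -> R).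
Local Notation leb := (@lebesgue_row R n).

Definition bounded_support u : Prop := exists M, forall y, M <= `|y| -> u y = 0.

Lemma partial_smooth u i : smooth u -> smooth (partial i u).
Proof. by move=> su s; have := su (rcons s i); rewrite foldr_rcons. Qed.

Lemma partial_bounded_support u i : bounded_support u -> bounded_support (partial i u).
Proof.
(* The margin 1 makes u vanish on a whole neighbourhood of y, so that its derivative vanishes at
   y. *)
move=> [M uM]; exists (M + 1) => y yM.
rewrite /partial (near_eq_derive (g := cst 0)); first by rewrite derive_cst.
have : \forall z \near (y : rV), M < `|z|.
  have : `|z| @[z --> (y : rV)] --> `|y| by exact: norm_continuous.
  by move/cvgr_gt; apply; rewrite (lt_le_trans _ yM)// ltrDl.
by apply: filterS => z /ltW/uM.
Qed.

Lemma test_function_bounded_support u : test_function u -> bounded_support u.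
Proof.
move=> [_ /compact_bounded[M [Mr MS]]]; exists (M + 2) => y yM.
apply/eqP; apply: contraT => uy.
have /MS : M < M + 1 by rewrite ltrDl.
have ySu : closure [set x | u x != 0] y by apply: subset_closure.
move=> /(_ y ySu) /=; lra.
Qed.

(** The sum of |D^w u| over all n^m words w of length m. Words instead of multi-indices, because
    each application of [riesz_bound] differentiates once more in every direction. *)
Fixpoint psum (m : nat) u : rV -> R :=
  if m is k.+1 then fun y => \sum_i psum k (partial i u) y else fun y => `|u y|.

Lemma psum_ge0 m u y : 0 <= psum m u y.
Proof. by elim: m u => [|m IH] u //=; apply: sumr_ge0. Qed.

Lemma continuous_psum m u : smooth u -> continuous (psum m u).
Proof.
elim: m u => [|m IH] u su /=.
  move=> y; apply: continuous_comp; last exact: norm_continuous.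
  by have [h _] := su [::]; exact: h.
by apply: continuous_sumR => i; apply: IH; exact: partial_smooth.
Qed.

(** The induction hypothesis is applied to each partial derivative inside the order 1 bound for u;
    Tonelli then brings the two kernels together and [riesz_compose] merges them. Orders start at 1,
    since the kernels compose only for positive orders. *)
Lemma iterated_riesz_bound (m : nat) : (0 < n)%N -> exists2 C : R, 0 <= C &
  forall u, smooth u -> bounded_support u -> forall x,
    (`|u x|%:E <= C%:E *
    \int[leb]_y (riesz m.+1%:R x y * (psum m.+1 u y)%:E))%E.
Proof.
move=> n0; elim: m => [|m [C C0 IH]].
  exists (2 `^ (n%:R - 1)); first exact: powR_ge0.
  move=> u su us x; apply: riesz_bound => //.
    by move=> i y; have [_ h] := su [::]; exact: h.
  by move=> i; have [h _] := su [:: i].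
have geoC : 0 <= 2 ^+ n * (geo 1 + geo m.+1%:R) * 2 `^ (n%:R - (1 + m.+1%:R)) :> R.
  by rewrite !mulr_ge0 ?powR_ge0 ?exprn_ge0 ?addr_ge0 ?geo_ge0 ?ltr0n.
exists (2 `^ (n%:R - 1) * (C * (2 ^+ n * (geo 1 + geo m.+1%:R) * 2 `^ (n%:R - (1 + m.+1%:R))))).
  by apply: mulr_ge0; [exact: powR_ge0|exact: mulr_ge0].
move=> u su us x.
have cp : continuous (psum m.+2 u) by exact: continuous_psum.
have mp : measurable_fun [set: rV] (fun y => (psum m.+2 u y)%:E).
  by apply/measurable_EFinP; exact: row_continuous_measurable.
have p0 y : (0 <= (psum m.+2 u y)%:E)%E by rewrite lee_fin psum_ge0.
apply: (@le_trans _ _ ((2 `^ (n%:R - 1))%:E * \int[leb]_y (riesz 1 x y *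
    (C%:E * \int[leb]_z (riesz m.+1%:R y z * (psum m.+2 u z)%:E))))%E).
  apply: (@le_trans _ _ ((2 `^ (n%:R - 1))%:E * \int[leb]_y (riesz 1 x y * (grad_sum u y)%:E))%E).
    apply: riesz_bound => //.
      by move=> i y; have [_ h] := su [::]; exact: h.
    by move=> i; have [h _] := su [:: i].
  apply: lee_wpmul2l; first by rewrite lee_fin powR_ge0.
  apply: le_ge0_integral => y _; first by rewrite mule_ge0 ?riesz_ge0 ?lee_fin ?grad_sum_ge0.
  apply: lee_wpmul2l; first exact: riesz_ge0.
  rewrite /grad_sum -sumEFin.
  apply: (@le_trans _ _ (\sum_i (C%:E *
     \int[leb]_z (riesz m.+1%:R y z * (psum m.+1 (partial i u) z)%:E)))%E).
    apply: lee_sum => i _; apply: IH; first exact: partial_smooth.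
    exact: partial_bounded_support.
  rewrite -ge0_sume_distrr; last first.
    by move=> i _; apply: integral_ge0 => z _; rewrite mule_ge0 ?riesz_ge0 ?lee_fin ?psum_ge0.
  rewrite -ge0_integral_sum//; last 2 first.
  - move=> i; apply: emeasurable_funM; first exact: measurable_rieszr.
    apply/measurable_EFinP; apply: row_continuous_measurable; apply: continuous_psum.
    exact: partial_smooth.
  - by move=> i z _; rewrite mule_ge0 ?riesz_ge0 ?lee_fin ?psum_ge0.
  apply: lee_wpmul2l; first by rewrite lee_fin.
  apply: le_of_eq; apply: eq_integral => z _.
  rewrite -ge0_sume_distrr; last by move=> i _; rewrite lee_fin psum_ge0.
  by rewrite sumEFin.
rewrite EFinM -muleA; apply: lee_wpmul2l; first by rewrite lee_fin powR_ge0.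
have mF : measurable_fun setT (fun p : rV * rV =>
    riesz 1 x p.1 * (riesz m.+1%:R p.1 p.2 * (psum m.+2 u p.2)%:E))%E.
  apply: emeasurable_funM.
    exact: (measurableT_comp (measurable_rieszr 1 x) measurable_fst).
  apply: emeasurable_funM; first exact: measurable_riesz.
  exact: (measurableT_comp mp measurable_snd).
have F0 p : (0 <= riesz 1 x p.1 * (riesz m.+1%:R p.1 p.2 * (psum m.+2 u p.2)%:E))%E.
  by rewrite !mule_ge0 ?riesz_ge0.
have -> : (\int[leb]_y (riesz 1 x y *
    (C%:E * \int[leb]_z (riesz m.+1%:R y z * (psum m.+2 u z)%:E))) =
  C%:E * \int[leb]_z \int[leb]_y (riesz 1 x y * (riesz m.+1%:R y z * (psum m.+2 u z)%:E)))%E.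
  rewrite -(fubini_tonelli (fun p : rV * rV =>
    riesz 1 x p.1 * (riesz m.+1%:R p.1 p.2 * (psum m.+2 u p.2)%:E))%E)//.
  rewrite -ge0_integralZl//; last 2 first.
  - exact: (measurable_fun_fubini_tonelli_F _ mF F0).
  - by move=> y _; apply: integral_ge0 => z _; exact: (F0 (y, z)).
  apply: eq_integral => y _; rewrite muleCA; congr (_ * _)%E.
  rewrite [RHS]/= [RHS]ge0_integralZl//.
  - apply: emeasurable_funM => //; exact: measurable_rieszr.
  - by move=> z _; exact: mule_ge0 (riesz_ge0 _ _ _) (p0 z).
rewrite EFinM -muleA; apply: lee_wpmul2l; first by rewrite lee_fin.
rewrite -ge0_integralZl//; last 2 first.
- by apply: emeasurable_funM => //; exact: measurable_rieszr.
- by move=> z _; rewrite mule_ge0 ?riesz_ge0.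
apply: le_ge0_integral => z _.
  by apply: integral_ge0 => y _; exact: (F0 (y, z)).
under eq_integral do rewrite muleA muleC.
rewrite ge0_integralZl//; last 2 first.
- apply: emeasurable_funM; first exact: measurable_rieszr.
  exact: measurable_rieszl.
- by move=> y _; rewrite mule_ge0 ?riesz_ge0.
rewrite muleC muleA; apply: lee_wpmul2r => //.
have -> : m.+2%:R = 1 + m.+1%:R :> R by rewrite -natr1 addrC.
by apply: riesz_compose; rewrite ?ltr01 ?ltr0n.
Qed.

End iterated.

(** * Symmetry of mixed partial derivatives and the gradient norm *)

Section mixed_partials.
Context {R : realType} {n : nat}.
Local Notation rV := 'rV[R]_n.
Implicit Types (x y z : rV) (u : rV -> R) (i j : 'I_n).
Local Notation leb := (@lebesgue_row R n).
Local Notation e_ := (unit_vector R).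

Lemma quotient_shift u y v (c : rV) :
  (fun h : R => h^-1 *: (((fun z => u (z + c)) \o shift y) (h *: v) - u (y + c))) =
  (fun h : R => h^-1 *: ((u \o shift (y + c)) (h *: v) - u (y + c))).
Proof. by apply/funext => h /=; rewrite addrA. Qed.

Lemma derivable_shift u y v (c : rV) :
  derivable u (y + c) v -> derivable (fun z => u (z + c)) y v.
Proof. by rewrite /derivable quotient_shift. Qed.

Lemma derive_shift u y v (c : rV) : 'D_v (fun z => u (z + c)) y = 'D_v u (y + c).
Proof. by rewrite /derive quotient_shift. Qed.

(** The mean value estimate is used twice: for the difference u(. + h e_j) - u in direction i, and
    for the i-th partial derivative of u in direction j. The bound h < d/2 keeps the points x + s
    e_i + t e_j within distance d of x. *)
Lemma mixed_increment u i j x (a e d h : R) : smooth u -> 0 < h < d / 2 ->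
  (forall y, `|y - x| < d -> `|partial j (partial i u) y - a| <= e) ->
  `|u (x + h *: e_ i + h *: e_ j) - u (x + h *: e_ i) - (u (x + h *: e_ j) - u x)
    - a * h * h| <= e * h * h.
Proof.
move=> su /andP[h0 hd] H.
pose w y := u (y + h *: e_ j) - u y.
have ud y k : derivable u y (e_ k) by have [_ hh] := su [::]; exact: hh.
have wd y : derivable w y (e_ i).
  by apply: derivableB; [exact: derivable_shift|exact: ud].
have wE y : partial i w y = partial i u (y + h *: e_ j) - partial i u y.
  rewrite /partial /w deriveB ?derive_shift//.
  exact: derivable_shift.
have := @partial_increment _ _ w i x h (a * h) (e * h) wd.
rewrite (gtr0_norm h0); apply=> s sh; rewrite wE.
have := @partial_increment _ _ (partial i u) j (x + s *: e_ i) h a e.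
rewrite (gtr0_norm h0); apply=> [y|t th].
  by have [_ hh] := su [:: i]; exact: hh.
apply: H; rewrite addrC -addrA addKr (le_lt_trans (ler_normD _ _))// !normrZ.
have d2 : d = d / 2 + d / 2 by rewrite -splitr.
rewrite d2 ltrD//; apply: le_lt_trans hd.
  by rewrite (le_trans _ sh)// ler_piMr// le_norm_delta.
by rewrite (le_trans _ th)// ler_piMr// le_norm_delta.
Qed.

(** Schwarz's theorem: the second difference is symmetric in i and j, and divided by h^2 it is
    within e/2 of either mixed derivative. It is needed because [multi_partial] takes derivatives in
    one fixed order, while [psum] runs over all words. *)
Lemma partialC u i j : smooth u -> partial i (partial j u) = partial j (partial i u).
Proof.
move=> su; apply/funext => x.
set a := RHS; set b := LHS.
apply/eqP; rewrite -subr_eq0 -normr_le0; apply/ler_addgt0Pl => e e0; rewrite addr0.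
have e2 : 0 < e / 2 by rewrite divr_gt0.
have near_ab k m : exists2 d, 0 < d & forall y, `|y - x| < d ->
    `|partial k (partial m u) y - partial k (partial m u) x| <= e / 2.
  have [kc _] := su [:: k; m].
  have /cvgrPdist_le/(_ _ e2)/nbhs_ballP[d /= d0 dB] := kc x.
  exists d => // y yx; rewrite distrC; apply: dB.
  by rewrite -ball_normE /ball_/= distrC.
have [d1 d10 H1] := near_ab j i; have [d2 d20 H2] := near_ab i j.
pose h := Num.min d1 d2 / 4.
have dm : 0 < Num.min d1 d2 by rewrite lt_min d10.
have h0 : 0 < h by rewrite divr_gt0.
have hd1 : 0 < h < d1 / 2.
  have : Num.min d1 d2 <= d1 by rewrite ge_min lexx.
  by rewrite h0 /h /=; move: dm; set m := Num.min _ _ => m0 md; lra.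
have hd2 : 0 < h < d2 / 2.
  have : Num.min d1 d2 <= d2 by rewrite ge_min lexx orbT.
  by rewrite h0 /h /=; move: dm; set m := Num.min _ _ => m0 md; lra.
have M1 := mixed_increment su hd1 H1; have M2 := mixed_increment su hd2 H2.
rewrite -/a in M1; rewrite -/b [x + h *: e_ j + _]addrAC in M2.
have hh0 : 0 < h * h by rewrite mulr_gt0.
rewrite -(ler_pM2r hh0) -[X in _ * X](gtr0_norm hh0) -normrM.
move: M1 M2; set A := u _; set B := u _; set C := u _; set D := u _.
move=> M1 M2.
have -> : (b - a) * (h * h) = (A - B - (C - D) - a * h * h) - (A - C - (B - D) - b * h * h) by ring.
apply: le_trans (ler_normB _ _) _; apply: le_trans (lerD M1 M2) _.
by apply: le_of_eq; field.
Qed.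

Lemma smooth_foldr u (s : seq 'I_n) : smooth u -> smooth (foldr (@partial R n) u s).
Proof. by move=> su t; have := su (t ++ s); rewrite foldr_cat. Qed.

Lemma foldr_partial_mid u i (s t : seq 'I_n) : smooth u ->
  foldr (@partial R n) u (s ++ i :: t) = foldr (@partial R n) u (i :: s ++ t).
Proof.
move=> su; elim: s => [//|j s IH] /=; rewrite IH /= partialC//.
exact: smooth_foldr.
Qed.

Lemma foldr_partial_perm u (s t : seq 'I_n) : smooth u -> perm_eq s t ->
  foldr (@partial R n) u s = foldr (@partial R n) u t.
Proof.
move=> su; elim: s t => [|i s IH] t.
  by rewrite perm_sym => /perm_nilP ->.
move=> st; have it : i \in t by rewrite -(perm_mem st) mem_head.
case/splitPr: it st => t1 t2 st; rewrite foldr_partial_mid//= (IH (t1 ++ t2))//.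
by move: st; rewrite perm_sym (perm_catCA t1 [:: i] t2) /= perm_cons perm_sym.
Qed.

Lemma multi_partialE (alpha : 'I_n -> nat) u :
  multi_partial alpha u =
  foldr (@partial R n) u (flatten [seq nseq (alpha i) i | i <- enum 'I_n]).
Proof.
rewrite /multi_partial; elim: (enum 'I_n) => //= i r ->.
by rewrite foldr_cat; elim: (alpha i) => //= k ->.
Qed.

(** A word and the sorted word with the same letter counts are permutations of each other. *)
Lemma multi_partial_count u (w : seq 'I_n) : smooth u ->
  foldr (@partial R n) u w = multi_partial (fun i => count_mem i w) u.
Proof.
move=> su; rewrite multi_partialE; apply: foldr_partial_perm => //.
apply/allP => i _ /=; apply/eqP; rewrite count_flatten sumnE !big_map.
under [RHS]eq_bigr do rewrite count_nseq.
rewrite -[Finite.enum _]enumT (bigD1_seq i) ?mem_enum ?enum_uniq//= eqxx mul1n.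
by rewrite big1 ?addn0// => j ji; rewrite (negPf ji) mul0n.
Qed.

Lemma sum_count_mem (w : seq 'I_n) : (\sum_i count_mem i w)%N = size w.
Proof.
elim: w => [|j w IH] /=; first by rewrite big1.
rewrite big_split/= IH (bigD1 j)//= eqxx big1 ?addn0 ?add1n// => i ij.
by rewrite eq_sym (negPf ij).
Qed.

(** The integrand of [grad_norm2] with all weights l!/alpha! replaced by 1. *)
Definition grad_square (l : nat) u y : R :=
  \sum_(alpha : {ffun 'I_n -> 'I_l.+1} | (\sum_i alpha i)%N == l)
     `|multi_partial (fun i => alpha i) u y| ^+ 2.

Lemma grad_square_ge0 l u y : 0 <= grad_square l u y.
Proof. by apply: sumr_ge0 => alpha _; rewrite exprn_ge0. Qed.

Lemma word_le_grad_square u (w : seq 'I_n) y : smooth u ->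
  `|foldr (@partial R n) u w y| <= Num.sqrt (grad_square (size w) u y).
Proof.
move=> su; rewrite -[leLHS]ger0_norm// -sqrtr_sqr ler_wsqrtr//.
pose alpha : {ffun 'I_n -> 'I_(size w).+1} := [ffun i => inord (count_mem i w)].
have alphaE i : alpha i = count_mem i w :> nat.
  by rewrite ffunE inordK// ltnS count_size.
rewrite /grad_square (bigD1 alpha)/=; last first.
  by rewrite -[X in _ == X]sum_count_mem; apply/eqP/eq_bigr => i _; exact: alphaE.
rewrite multi_partial_count//.
rewrite (_ : (fun i => count_mem i w) = (fun i => nat_of_ord (alpha i))); last first.
  by apply/funext => i; rewrite alphaE.
by rewrite lerDl; apply: sumr_ge0 => beta _; rewrite exprn_ge0.
Qed.

Lemma psum_le_grad_square l u y : smooth u ->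
  psum l u y <= n%:R ^+ l * Num.sqrt (grad_square l u y).
Proof.
move=> su.
(* Generalized over the word w of derivatives already taken, so that the induction can move letters
   from the sum into w. *)
suff : forall m (w : seq 'I_n), (m + size w)%N = l ->
    psum m (foldr (@partial R n) u w) y <= n%:R ^+ m * Num.sqrt (grad_square l u y).
  by move=> /(_ l [::]); rewrite addn0; exact.
elim=> [|m IH] w /=.
  by rewrite add0n expr0 mul1r => <-; exact: word_le_grad_square.
move=> mw.
apply: (@le_trans _ _ (\sum_(i < n) n%:R ^+ m * Num.sqrt (grad_square l u y))).
  by apply: ler_sum => i _; apply: (IH (i :: w)); rewrite /= addnS -mw addSn.
by rewrite sumr_const card_ord exprS -mulrA mulr_natl.
Qed.

(** The factor n^(2l) is the square of the number of words. The factor (l!)^n compensates the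
    weights: alpha! <= (l!)^n, as every entry of alpha is at most l. *)
Lemma integral_psum2_le l u : smooth u ->
  (\int[leb]_y ((psum l u y ^+ 2)%:E) <=
   (n%:R ^+ l ^+ 2 * (l`!%:R ^+ n))%:E * grad_norm2 l u)%E.
Proof.
move=> su.
have mpc (alpha : {ffun 'I_n -> 'I_l.+1}) :
    continuous (multi_partial (fun i => alpha i) u).
  by rewrite multi_partialE; have [h _] := su (flatten [seq nseq (alpha i) i | i <- enum 'I_n]).
have mm (alpha : {ffun 'I_n -> 'I_l.+1}) : measurable_fun [set: rV]
    (fun y => (`|multi_partial (fun i => alpha i) u y| ^+ 2)%:E).
  apply/measurable_EFinP; apply: row_continuous_measurable.
  have nc : continuous (fun y : rV => `|multi_partial (fun i => alpha i) u y|).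
    by move=> y; apply: (continuous_comp (mpc alpha y)); exact: norm_continuous.
  by move=> y; exact: (cvgM (nc y) (nc y)).
apply: (@le_trans _ _ (\int[leb]_y ((n%:R ^+ l ^+ 2)%:E * (grad_square l u y)%:E))%E).
  apply: le_ge0_integral => y _; first by rewrite lee_fin exprn_ge0 ?psum_ge0.
  rewrite -EFinM lee_fin -[X in _ * X]sqr_sqrtr ?grad_square_ge0// -exprMn.
  rewrite lerXn2r ?nnegrE ?psum_ge0 ?mulr_ge0 ?exprn_ge0 ?sqrtr_ge0//.
  exact: psum_le_grad_square.
have gsE y : (grad_square l u y)%:E =
    (\sum_(alpha : {ffun 'I_n -> 'I_l.+1} | (\sum_i alpha i)%N == l)
     (`|multi_partial (fun i => alpha i) u y| ^+ 2)%:E)%E by rewrite sumEFin.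
rewrite ge0_integralZl//; last 2 first.
- by under eq_fun do rewrite gsE -big_filter; exact: emeasurable_sum.
- by move=> y _; rewrite lee_fin grad_square_ge0.
rewrite EFinM -muleA; apply: lee_wpmul2l; first by rewrite lee_fin exprn_ge0.
under eq_integral do rewrite gsE -big_filter.
rewrite ge0_integral_sum//.
rewrite big_filter.
have I0 (alpha : {ffun 'I_n -> 'I_l.+1}) :
    (0 <= \int[leb]_y (`|multi_partial (fun i => alpha i) u y| ^+ 2)%:E)%E.
  by apply: integral_ge0 => y _; rewrite lee_fin exprn_ge0.
have fp k : 0 < k`!%:R :> R by rewrite ltr0n fact_gt0.
have pp (alpha : {ffun 'I_n -> 'I_l.+1}) : 0 < (\prod_i (alpha i)`!)%:R :> R.
  by rewrite ltr0n prodn_gt0// => i; exact: fact_gt0.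
rewrite /grad_norm2 ge0_sume_distrr; last first.
  by move=> alpha _; rewrite mule_ge0// lee_fin divr_ge0// ltW.
apply: lee_sum => alpha _.
rewrite muleA -EFinM -[leLHS]mul1e; apply: lee_wpmul2r => //.
rewrite lee_fin mulrA ler_pdivlMr// mul1r.
apply: (@le_trans _ _ (l`!%:R ^+ n)).
  rewrite natr_prod -[in X in _ ^+ X](card_ord n) -prodr_const.
  by apply: ler_prod => i _; rewrite ler0n ler_nat leq_fact -1?ltnS.
by rewrite ler_peMr ?exprn_ge0// ler1n fact_gt0.
Qed.

End mixed_partials.

(** * Measure versus capacity *)

Section energy.
Context {R : realType} {n : nat}.
Local Notation rV := 'rV[R]_n.
Implicit Types (x y z : rV) (u : rV -> R).
Local Notation leb := (@lebesgue_row R n).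

Lemma geo_gt0 (b : R) : 0 < b -> 0 < geo b.
Proof.
move=> b0; rewrite invr_gt0 subr_gt0 powRN invf_lt1 ?powR_gt0//.
by have := @gt0_ltr_powR R b b0 1 2; rewrite !nnegrE powR1; apply; rewrite ?ltr1n.
Qed.

Lemma cubeE x (d : R) : 0 < d -> cube x d = [set y : rV | `|x - y| < d / 2].
Proof.
move=> d0; have d20 : 0 < d / 2 by rewrite divr_gt0.
apply/seteqP; split => y /=.
  by move=> h; apply/(row_normP _ d20) => i; rewrite !mxE distrC; exact: h.
by move/(row_normP _ d20) => h i; rewrite distrC; have := h i; rewrite !mxE.
Qed.

(** At each scale the mass of the ball is bounded by c (2 dyadic k)^s or by M. The first bound is
    summable over small scales as n - b < s, the second over large scales as b < n. *)
Lemma riesz_potential_le (s b c : R) (m : {finite_measure set rV -> \bar R}) (M : R) x :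
  0 < s -> 0 < c -> b < n%:R -> n%:R - b < s ->
  (forall x d, 0 < d -> (m (cube x d) <= (c * d `^ s)%:E)%E) ->
  m setT = M%:E -> 0 < M ->
  (\int[m]_y riesz b x y <=
   ((c * 2 `^ s * geo (s - (n%:R - b)) + geo (n%:R - b)) *
     (M / M `^ ((n%:R - b) / s)))%:E)%E.
Proof.
move=> s0 c0 bn bs mc mM M0.
have mB (t : R) : measurable [set y : rV | `|x - y| < t].
  rewrite -[X in measurable X]setTI.
  by apply: (measurableT_comp (measurable_dist_lt t) (measurable_pair1 x)).
pose B (k : int) := [set y : rV | `|x - y| < dyadic k].
have -> : (\int[m]_y riesz b x y =
    zsum (fun k => (dyadic k `^ (b - n%:R))%:E * m (B k)))%E.
  rewrite integral_zsum; last 2 first.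
  - by move=> k; exact: measurable_scale_kernelr.
  - by move=> k y; exact: scale_kernel_ge0.
  congr zsum; apply/funext => k.
  under eq_integral do rewrite /scale_kernel EFinM.
  rewrite ge0_integralZl//; last 2 first.
  - apply/measurable_EFinP/measurable_boolR.
    exact: (measurableT_comp (measurable_dist_lt _) (measurable_pair1 x)).
  - by rewrite lee_fin powR_ge0.
  congr (_ * _)%E; have := integral_indic m measurableT (mB (dyadic k)).
  rewrite setIT => <-; apply: eq_integral => y _.
  rewrite indicE; congr ((nat_of_bool _)%:R%:E).
  by apply/idP/idP; rewrite inE.
(* The scale at which the two bounds have the same order, w^s = M. *)
set w := M `^ s^-1; have w0 : 0 < w by rewrite powR_gt0.
have mb0 : 0 < n%:R - b by rewrite subr_gt0.
have sg0 : 0 < s - (n%:R - b) by rewrite subr_gt0.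
have c20 : 0 <= c * 2 `^ s by rewrite mulr_ge0 ?powR_ge0 ?ltW.
pose T1 (k : int) := ((c * 2 `^ s)%:E * (dyadic k `^ (s - (n%:R - b)) * (dyadic k <= w)%R%:R)%:E)%E.
pose T2 (k : int) := (M%:E * (dyadic k `^ (- (n%:R - b)) * (w <= dyadic k)%R%:R)%:E)%E.
have T10 k : (0 <= T1 k)%E by rewrite /T1 -EFinM lee_fin !mulr_ge0 ?powR_ge0 // ltW.
have T20 k : (0 <= T2 k)%E by rewrite /T2 -EFinM lee_fin !mulr_ge0 ?powR_ge0 // ltW.
apply: (@le_trans _ _ (zsum (fun k => T1 k + T2 k)%E)).
  apply: le_zsum => k.
  have [kw|wk] := leP (dyadic k) w.
    apply: (@le_trans _ _ (T1 k)); last by rewrite leeDl.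
    rewrite /T1 kw mulr1 -EFinM.
    apply: (@le_trans _ _ ((dyadic k `^ (b - n%:R))%:E * (c * (2 * dyadic k) `^ s)%:E)%E).
      apply: lee_wpmul2l; first by rewrite lee_fin powR_ge0.
      have B0 : 0 < 2 * dyadic k :> R by rewrite mulr_gt0 ?dyadic_gt0.
      have BE : 2 * dyadic k / 2 = dyadic k :> R by field.
      by have := mc x _ B0; rewrite cubeE// BE.
    rewrite -EFinM lee_fin powRM ?dyadic_ge0//; apply: le_of_eq.
    have -> : s - (n%:R - b) = (b - n%:R) + s by ring.
    by rewrite (@powRD _ (dyadic k) (b - n%:R)) ?(gt_eqF (dyadic_gt0 _)) ?implybT//; ring.
  apply: (@le_trans _ _ (T2 k)); last by rewrite leeDr.
  rewrite /T2 (ltW wk) mulr1 opprB muleC; apply: lee_wpmul2r; first by rewrite lee_fin powR_ge0.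
  by rewrite -mM; apply: le_measure; rewrite ?inE//; exact: mB.
rewrite zsumD// /T1 /T2 !zsumZl//; last 3 first.
- by move=> k; rewrite lee_fin mulr_ge0 ?powR_ge0.
- exact: ltW.
- by move=> k; rewrite lee_fin mulr_ge0 ?powR_ge0.
rewrite mulrDl EFinD; apply: leeD.
  apply: (le_trans (lee_wpmul2l _ (dyadic_le_sum sg0 w0))); first by rewrite lee_fin.
  rewrite -EFinM lee_fin -mulrA ler_wpM2l// mulrC ler_wpM2l ?geo_ge0//.
  rewrite /w -powRrM mulrBr mulVf ?gt_eqF// powRB ?(gt_eqF M0) ?implybT//.
  by rewrite powRr1 ?(ltW M0)// [s^-1 * _]mulrC.
apply: (le_trans (lee_wpmul2l _ (dyadic_ge_sum mb0 w0))); first by rewrite lee_fin ltW.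
rewrite -EFinM lee_fin [leLHS](_ : _ = geo (n%:R - b) * (M * w `^ (- (n%:R - b)))); last first.
  by rewrite /geo; ring.
apply: ler_wpM2l; first exact: geo_ge0.
by apply: le_of_eq; rewrite /w -powRrM mulrN powRN [s^-1 * _]mulrC.
Qed.

End energy.

(** * Lower bound of the gradient norm by the mass of a measure *)

Section capacity_inequality.
Context {R : realType} {n : nat}.
Local Notation rV := 'rV[R]_n.
Implicit Types (x y z : rV) (u : rV -> R).
Local Notation leb := (@lebesgue_row R n).

(* The left-hand side is the squared L^2 norm of the potential of order a of m. *)
Lemma energy_le (a A M : R) (m : {finite_measure set rV -> \bar R}) :
  0 < a -> m setT = M%:E ->
  (forall x, (\int[m]_y riesz (a + a) x y <= A%:E)%E) ->
  (\int[leb]_y ((\int[m]_x riesz a x y) * (\int[m]_x riesz a x y)) <=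
    (2 ^+ n * (geo a + geo a) * 2 `^ (n%:R - (a + a)) * A * M)%:E)%E.
Proof.
move=> a0 mM mA.
pose W y := (\int[m]_x riesz a x y)%E.
set C := 2 ^+ n * (geo a + geo a) * 2 `^ (n%:R - (a + a)).
have C0 : 0 <= C by rewrite !mulr_ge0 ?powR_ge0 ?exprn_ge0 ?addr_ge0 ?geo_ge0.
have W0 y : (0 <= W y)%E by apply: integral_ge0 => x _; exact: riesz_ge0.
have mW : measurable_fun [set: rV] W.
  apply: (measurable_fun_fubini_tonelli_G (fun p : rV * rV => riesz a p.1 p.2)).
    exact: measurable_riesz.
  by move=> p; exact: riesz_ge0.
have mF : measurable_fun [set: rV * rV] (fun p => riesz a p.1 p.2 * W p.2)%E.
  apply: emeasurable_funM; first exact: measurable_riesz.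
  exact: (measurableT_comp mW measurable_snd).
have F0 (p : rV * rV) : (0 <= riesz a p.1 p.2 * W p.2)%E by rewrite mule_ge0 ?riesz_ge0.
(* The square is opened into a double integral against m, in x here and in z below; with the
   integral in y innermost, the two kernels of order a compose to order a + a. *)
have -> : (\int[leb]_y (W y * W y) = \int[leb]_y \int[m]_x (riesz a x y * W y))%E.
  apply: eq_integral => y _; rewrite {1}/W ge0_integralZr//.
  exact: measurable_rieszl.
rewrite -(fubini_tonelli (fun p : rV * rV => riesz a p.1 p.2 * W p.2)%E)//.
apply: (@le_trans _ _ (\int[m]_x (C * A)%:E)%E); last first.
  by rewrite integral_cst// [X in (_ * X)%E](_ : _ = M%:E).
apply: le_ge0_integral => x _.
  by apply: integral_ge0 => y _; exact: (F0 (x, y)).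
have mG : measurable_fun [set: rV * rV] (fun p => riesz a x p.1 * riesz a p.2 p.1)%E.
  apply: emeasurable_funM.
    exact: (measurableT_comp (measurable_rieszr a x) measurable_fst).
  by under eq_fun do rewrite rieszC; exact: measurable_riesz.
have G0 (p : rV * rV) : (0 <= riesz a x p.1 * riesz a p.2 p.1)%E.
  by rewrite mule_ge0 ?riesz_ge0.
have -> : (\int[leb]_y (riesz a x y * W y) =
    \int[leb]_y \int[m]_z (riesz a x y * riesz a z y))%E.
  apply: eq_integral => y _; rewrite /W ge0_integralZl//.
  exact: measurable_rieszl.
rewrite (fubini_tonelli (fun p : rV * rV => riesz a x p.1 * riesz a p.2 p.1)%E)//.
apply: (@le_trans _ _ (\int[m]_z (C%:E * riesz (a + a) x z))%E).
  apply: le_ge0_integral => z _; first by apply: integral_ge0 => y _; exact: (G0 (y, z)).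
  by under eq_integral do rewrite [riesz a z _]rieszC; exact: riesz_compose.
rewrite ge0_integralZl//; last exact: measurable_rieszr.
rewrite [leRHS]EFinM; apply: lee_wpmul2l; first by rewrite lee_fin.
exact: mA.
Qed.

(** As u >= 1 on K, which carries m, M is at most the integral of |u|, hence of the potential of m
    against [psum l u]. The energy of m is O(M^(2 - beta)), with beta the exponent of M in the
    conclusion. *)
Lemma capacity_inequality (l : nat) (s c : R) : (0 < l)%N -> (2 * l < n)%N ->
  n%:R - (2 * l)%:R < s -> 0 < c ->
  exists2 C : R, 0 < C &
  forall (m : {finite_measure set rV -> \bar R}) (M : R) (K : set rV) u,
    (forall x d, 0 < d -> (m (cube x d) <= (c * d `^ s)%:E)%E) ->
    m setT = M%:E -> 0 < M -> measurable K -> m K = m setT ->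
    test_function u -> (forall x, K x -> 1 <= u x) ->
    ((M `^ ((n%:R - (2 * l)%:R) / s))%:E <= C%:E * grad_norm2 l u)%E.
Proof.
move=> l0 ln ns c0.
have n0 : (0 < n)%N by apply: leq_ltn_trans ln.
have ln' : (2 * l)%:R < n%:R :> R by rewrite ltr_nat.
have s0 : 0 < s by apply: lt_trans ns; rewrite subr_gt0.
have l0' : 0 < l%:R :> R by rewrite ltr0n.
have [C1 C10 HC1] := @iterated_riesz_bound R n l.-1 n0.
rewrite prednK// in HC1.
pose A3 := c * 2 `^ s * geo (s - (n%:R - (2 * l)%:R)) + geo (n%:R - (2 * l)%:R).
pose C2 : R := 2 ^+ n * (geo l%:R + geo l%:R) * 2 `^ (n%:R - (l%:R + l%:R)).
(* The summand 1 makes A positive, since the weight t below is divided by. *)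
pose A : R := C1 * (C2 * A3) + 1.
pose C4 : R := n%:R ^+ l ^+ 2 * (l`!%:R ^+ n).
have C40 : 0 <= C4 by rewrite mulr_ge0 ?exprn_ge0.
have C20 : 0 <= C2 by rewrite !mulr_ge0 ?powR_ge0 ?exprn_ge0 ?addr_ge0 ?geo_ge0.
have A30 : 0 <= A3.
  rewrite addr_ge0 ?mulr_ge0 ?powR_ge0 ?geo_ge0 ?subr_gt0// ltW//.
have A0 : 0 < A by rewrite ltr_wpDl// mulr_ge0// mulr_ge0.
have K0 : 0 < 4 * A * C1 * C4 + 1.
  by rewrite ltr_wpDl// mulr_ge0// mulr_ge0// mulr_ge0// ltW.
exists (4 * A * C1 * C4 + 1); first exact: K0.
move=> m M K u mc mM M0 mK mKT tu uK.
have us := test_function_bounded_support tu; have su := tu.1.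
set q := M `^ _; have q0 : 0 < q by rewrite powR_gt0.
have [->|gfin] := eqVneq (grad_norm2 l u) +oo%E.
  by rewrite gt0_muley ?leey// lte_fin.
have g0 : (0 <= grad_norm2 l u)%E.
  apply: sume_ge0 => alpha _; rewrite mule_ge0 ?lee_fin ?divr_ge0//.
  by apply: integral_ge0 => y _; rewrite lee_fin exprn_ge0.
have gE : grad_norm2 l u = (fine (grad_norm2 l u))%:E.
  by rewrite fineK// ge0_fin_numE// ltey.
move: (fine _) gE => D gE; rewrite gE in g0 *; rewrite lee_fin in g0.
pose P y : R := psum l u y.
have P0 y : 0 <= P y := psum_ge0 _ _ _.
have mP : measurable_fun [set: rV] P.
  by apply: row_continuous_measurable; exact: continuous_psum.
pose W y := (\int[m]_x riesz l%:R x y)%E.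
have W0 y : (0 <= W y)%E by apply: integral_ge0 => x _; exact: riesz_ge0.
have mW : measurable_fun [set: rV] W.
  apply: (measurable_fun_fubini_tonelli_G (fun p : rV * rV => riesz l%:R p.1 p.2)).
    exact: measurable_riesz.
  by move=> p; exact: riesz_ge0.
have step1 : (M%:E <= C1%:E * \int[leb]_y (W y * (P y)%:E))%E.
  apply: (@le_trans _ _ (\int[m]_x `|u x|%:E)%E).
    have -> : M%:E = (\int[m]_(x in K) cst 1%E x)%E by rewrite integral_cst// mul1e -mM -mKT.
    rewrite integral_mkcond; apply: le_ge0_integral => x _; first by apply: erestrict_ge0.
    rewrite patchE; case: ifPn => [xK|_]; rewrite lee_fin//.
    by rewrite (le_trans (uK x (set_mem xK)))// ler_norm.
  have mF : measurable_fun [set: rV * rV] (fun p => riesz l%:R p.1 p.2 * (P p.2)%:E)%E.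
    apply: emeasurable_funM; first exact: measurable_riesz.
    by apply/measurable_EFinP; exact: (measurableT_comp mP measurable_snd).
  have F0 (p : rV * rV) : (0 <= riesz l%:R p.1 p.2 * (P p.2)%:E)%E.
    by rewrite mule_ge0 ?riesz_ge0 ?lee_fin.
  apply: (@le_trans _ _ (\int[m]_x (C1%:E * \int[leb]_y (riesz l%:R x y * (P y)%:E)))%E).
    by apply: le_ge0_integral => x _ //; exact: HC1.
  rewrite ge0_integralZl//; last 2 first.
  - exact: (measurable_fun_fubini_tonelli_F _ mF F0).
  - by move=> x _; apply: integral_ge0 => y _; exact: (F0 (x, y)).
  apply: lee_wpmul2l; first by rewrite lee_fin.
  rewrite (fubini_tonelli (fun p : rV * rV => riesz l%:R p.1 p.2 * (P p.2)%:E)%E)//.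
  apply: le_of_eq; apply: eq_integral => y _; rewrite /= ge0_integralZr ?lee_fin//.
  exact: measurable_rieszl.
have ll : l%:R + l%:R = (2 * l)%:R :> R by rewrite mul2n -addnn natrD.
have step2 : (\int[leb]_y (W y * W y) <= (C2 * (A3 * (M / q)) * M)%:E)%E.
  apply: energy_le => // x; rewrite ll.
  exact: riesz_potential_le.
have step3 : (\int[leb]_y ((P y ^+ 2)%:E) <= (C4 * D)%:E)%E.
  by rewrite EFinM -gE; exact: integral_psum2_le.
(* Pointwise, t P^2 + W^2 / t bounds even 2 W P; the factor 2 is given away. *)
have young (t : R) : 0 < t ->
    (\int[leb]_y (W y * (P y)%:E) <= (t * (C4 * D) + t^-1 * (C2 * (A3 * (M / q)) * M))%:E)%E.
  move=> t0; rewrite EFinD [(t * _)%:E]EFinM [(t^-1 * _)%:E]EFinM.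
  apply: (@le_trans _ _ (\int[leb]_y (t%:E * (P y ^+ 2)%:E + t^-1%:E * (W y * W y)))%E).
    apply: le_ge0_integral => y _; first by rewrite mule_ge0 ?lee_fin.
    move: (W y) (W0 y) => [w| |]//; last first.
      by rewrite mulyy gt0_muley ?lte_fin ?invr_gt0// addey ?leey.
    rewrite -!EFinM -EFinD !lee_fin => w0.
    have := sqr_ge0 (t * P y - w); have := sqr_ge0 (t * P y + w).
    have -> : t * P y ^+ 2 + t^-1 * (w * w) = t^-1 * ((t * P y) ^+ 2 + w * w).
      by field; rewrite gt_eqF.
    move=> h1 h2; rewrite -ler_pdivrMl ?invr_gt0// invrK.
    by move: (P0 y) => py; nra.
  rewrite ge0_integralD//; last 4 first.
  - by move=> y _; rewrite -EFinM lee_fin mulr_ge0 ?sqr_ge0 ?ltW.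
  - apply: emeasurable_funM => //; apply/measurable_EFinP.
    exact: measurable_funX.
  - by move=> y _; rewrite !mule_ge0// lee_fin invr_ge0 ltW.
  - by apply: emeasurable_funM => //; apply: emeasurable_funM.
  apply: leeD.
    rewrite ge0_integralZl//.
    - by apply: lee_wpmul2l => //; rewrite lee_fin ltW.
    - by apply/measurable_EFinP; exact: measurable_funX.
    - by move=> y _; rewrite lee_fin sqr_ge0.
    - by rewrite lee_fin ltW.
  rewrite ge0_integralZl//.
  - by apply: lee_wpmul2l => //; rewrite lee_fin invr_ge0 ltW.
  - exact: emeasurable_funM.
  - by move=> y _; rewrite mule_ge0.
  - by rewrite lee_fin invr_ge0 ltW.
(* With this weight the energy term is at most M/2 and is absorbed by the left-hand side; the
   factors 2 of t and of the absorption give the 4 in the constant. *)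
pose t := 2 * A * (M / q).
have t0 : 0 < t by rewrite !mulr_gt0 ?invr_gt0.
have := le_trans step1 (lee_wpmul2l _ (young t t0)); rewrite lee_fin => /(_ C10).
rewrite -!EFinM !lee_fin => main.
have main2 : M <= 2 * A * C1 * C4 * D * (M / q) + M / 2.
  apply: le_trans main _; rewrite mulrDr lerD//.
    by apply: le_of_eq; rewrite /t; ring.
  rewrite [leLHS](_ : _ = t^-1 * (M / q) * M * (C1 * (C2 * A3))); last by ring.
  apply: (@le_trans _ _ (t^-1 * (M / q) * M * A)).
    by rewrite ler_wpM2l ?mulr_ge0 ?invr_ge0 ?ltW// /A ltrDl.
  by apply: le_of_eq; rewrite /t; field; rewrite !gt_eqF.
have {}main2 : M / 2 * q <= 2 * A * C1 * C4 * D * M.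
  have : M / 2 <= 2 * A * C1 * C4 * D * (M / q) by lra.
  by rewrite mulrA ler_pdivlMr.
have {}main2 : q <= 4 * A * C1 * C4 * D by nra.
by rewrite (le_trans main2)// ler_wpM2r// lerDl.
Qed.

End capacity_inequality.

(** * Inner regularity of finite Borel measures *)

Lemma nonincreasing_measure_lt d (T : measurableType d) (R : realType)
    (m : {finite_measure set T -> \bar R}) (F : nat -> set T) (b : \bar R) :
  (forall k, measurable (F k)) -> nonincreasing_seq F -> (m (\bigcap_k F k) < b)%E ->
  exists k, (m (F k) < b)%E.
Proof.
move=> mF dF mb.
have cF : m \o F @ \oo --> m (\bigcap_k F k).
  apply: nonincreasing_cvg_mu => //.
    by rewrite -ge0_fin_numE// fin_num_measure.
  exact: bigcapT_measurable.
have [N _ HN] := cF _ (open_nbhs_nbhs (conj (@open_ereal_lt_ereal _ b) mb)).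
by exists N; apply: (HN N) => /=.
Qed.

Section regularity.
Context {R : realType} {n : nat}.
Local Notation rV := 'rV[R]_n.
Variable m : {finite_measure set rV -> \bar R}.

(** Two-sided approximation is required because it passes to complements, where closed and open sets
    exchange roles; inner approximation alone does not. *)
Definition sandwiched (A : set rV) : Prop := forall e : R, 0 < e ->
  exists F W, [/\ closed F, open W, F `<=` A, A `<=` W & (m (W `\` F) < e%:E)%E].

(** The points at distance at least 1/(k+1) from the complement of A; for open A these closed sets
    increase to A. *)
Let closed_core (A : set rV) (k : nat) : set rV :=
  [set x | forall y, `|x - y| < k.+1%:R^-1 -> A y].

Let closed_closed_core A k : closed (closed_core A k).
Proof.
rewrite -(setCK (closed_core A k)); apply: open_closedC.
rewrite openE => x /= /existsNP[y /not_implyP[xy nAy]].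
have e0 : 0 < k.+1%:R^-1 - `|x - y| by rewrite subr_gt0.
apply/nbhs_ballP; exists (k.+1%:R^-1 - `|x - y|); first exact: e0.
move=> z.
rewrite -ball_normE /ball_/= => xz Hz; apply: nAy; apply: Hz.
by rewrite (le_lt_trans (ler_distD x _ _))// [`|z - x|]distrC -ltrBrDr.
Qed.

Lemma open_sandwiched A : open A -> sandwiched A.
Proof.
move=> oA e e0.
pose G k := A `\` closed_core A k.
have [k mk] : exists k, (m (G k) < e%:E)%E.
  apply: nonincreasing_measure_lt.
  - move=> k; apply: measurableD; first exact: row_open_measurable.
    by apply: row_closed_measurable; exact: closed_closed_core.
  - move=> i j ij; apply/subsetPset => x [Ax nx]; split => // xi; apply: nx.
    move=> y xy; apply: xi; apply: lt_le_trans xy _.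
    by rewrite lef_pV2 ?posrE ?ltr0n// ler_nat.
  rewrite (_ : \bigcap_k G k = set0) ?measure0 ?lte_fin//.
  apply/seteqP; split => // x Gx.
  have Ax : A x by have [] := Gx 0%N I.
  have /nbhs_ballP[d /= d0 dA] := open_nbhs_nbhs (conj oA Ax).
  have [k kd] : exists k : nat, k.+1%:R^-1 < d.
    exists (Num.bound d^-1); rewrite invf_plt ?posrE// (lt_le_trans (archi_boundP _))//.
      by rewrite invr_ge0 ltW.
    by rewrite ler_nat.
  have [_] := Gx k I; apply=> y xy; apply: dA.
  by rewrite -ball_normE /ball_/= (lt_trans xy).
exists (closed_core A k), A; split => //.
by move=> x; apply; rewrite subrr normr0 invr_gt0 ltr0n.
Qed.

Lemma setC_sandwiched A : sandwiched A -> sandwiched (~` A).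
Proof.
move=> sA e /sA[F [W [cF oW FA AO mOF]]]; exists (~` W), (~` F); split.
- exact: open_closedC.
- exact: closed_openC.
- exact: subsetC.
- exact: subsetC.
- by rewrite setDE setCK setIC -setDE.
Qed.

Lemma bigcup_sandwiched (A : nat -> set rV) :
  (forall k, sandwiched (A k)) -> sandwiched (\bigcup_k A k).
Proof.
move=> sA e e0.
have e2 : 0 < e / 2 by rewrite divr_gt0.
have ek k : 0 < e / 2 / (2 ^ k.+1)%:R by rewrite divr_gt0// ltr0n expn_gt0.
have [F HF] := choice (fun k => sA k _ (ek k)).
have [W HW] := choice HF.
(* An infinite union of closed sets need not be closed, so only finitely many F_i are kept. The sets
   G k decrease to a set of measure at most the sum of e/2/2^(k+1), that is e/2, and so some G k has
   measure below e. *)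
pose G k := \bigcup_i W i `\` \bigcup_(i < k) F i.
have mW k : measurable (W k) by apply: row_open_measurable; have [] := HW k.
have mF k : measurable (F k) by apply: row_closed_measurable; have [] := HW k.
have [k mk] : exists k, (m (G k) < e%:E)%E.
  apply: nonincreasing_measure_lt.
  - move=> k; apply: measurableD; first exact: bigcupT_measurable.
    exact: bigcup_measurable.
  - move=> i j ij; apply/subsetPset => x [Ox nx]; split => // -[k /= ki Fx].
    by apply: nx; exists k => //=; exact: leq_trans ij.
  have mOF k : measurable (W k `\` F k) by exact: measurableD.
  apply: (@le_lt_trans _ _ (e / 2)%:E); last by rewrite lte_fin; lra.
  apply: (@le_trans _ _ (\sum_(k <oo) m (W k `\` F k))%E).
    apply: measure_sigma_subadditive => //.
      apply: bigcapT_measurable => k; apply: measurableD; first exact: bigcupT_measurable.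
      exact: bigcup_measurable.
    move=> x Gx; have [[i _ Oi] _] := Gx 0%N I; exists i => //; split => // Fi.
    by have [_] := Gx i.+1 I; apply; exists i => //=.
  apply: (@le_trans _ _ (\sum_(k <oo) (0 + (e / 2 / (2 ^ k.+1)%:R)%:E))%E).
    by apply: lee_nneseries => // k _; rewrite add0e; have [_ _ _ _ /ltW] := HW k.
  apply: le_trans (epsilon_trick xpredT _ (ltW e2)) _ => //.
  by rewrite eseries0// add0e.
exists (\bigcup_(i < k) F i), (\bigcup_i W i); split => //.
- apply: closed_bigcup => //.
  by move=> i _; have [] := HW i.
- by apply: bigcup_open => i _; have [] := HW i.
- by move=> x [i _ Fx]; exists i => //; have [_ _ h _ _] := HW i; exact: h.
- by move=> x [i _ Ax]; exists i => //; have [_ _ _ h _] := HW i; exact: h.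
Qed.

Lemma measurable_sandwiched (A : set rV) : measurable A -> sandwiched A.
Proof.
suff : <<s @open rV >> `<=` sandwiched by apply.
apply: smallest_sub; last by move=> B; exact: open_sandwiched.
split; first exact: open_sandwiched open0.
  by move=> B sB; rewrite setTD; exact: setC_sandwiched.
exact: bigcup_sandwiched.
Qed.

Lemma inner_regular (A : set rV) (e : R) : measurable A -> 0 < e ->
  exists F, [/\ closed F, F `<=` A & (m (A `\` F) < e%:E)%E].
Proof.
move=> mA e0; have [F [W [cF oW FA AO mOF]]] := measurable_sandwiched mA e0.
exists F; split => //; apply: le_lt_trans mOF; apply: le_measure; rewrite ?inE.
- by apply: measurableD => //; exact: row_closed_measurable.
- by apply: measurableD; [exact: row_open_measurable|exact: row_closed_measurable].
- exact: setSD.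
Qed.

End regularity.

(** * Isocapacitary inequality on the support *)

Section isocapacitary.
Context {R : realType} {n : nat}.
Local Notation rV := 'rV[R]_n.
Implicit Types (x y : rV) (nu : {measure set rV -> \bar R}).

Definition upper_regular nu (s c : R) : Prop :=
  forall x d, msupport nu x -> 0 < d -> (nu (cube x d) <= (c * d `^ s)%:E)%E.

Lemma closed_msupport nu : closed (msupport nu).
Proof.
rewrite -(setCK (msupport nu)); apply: open_closedC.
rewrite (_ : ~` _ = \bigcup_(U in [set U | open U /\ ~ (0 < nu U)%E]) U).
  by apply: bigcup_open => U [].
apply/seteqP; split => [x /existsNP[U /not_implyP[oU /not_implyP[Ux nU]]]|].
  by exists U.
by move=> x [U [oU nU] Ux] /(_ U oU Ux).
Qed.

Lemma measurable_msupport nu : measurable (msupport nu).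
Proof. by apply: row_closed_measurable; exact: closed_msupport. Qed.

Lemma measurable_cube x (d : R) : 0 < d -> measurable (cube x d).
Proof.
move=> d0; rewrite cubeE// -[X in measurable X]setTI.
by apply: (measurableT_comp (measurable_dist_lt _) (measurable_pair1 x)).
Qed.

(** The center is arbitrary: a cube that meets the support at y lies in the cube of twice the edge
    around y, whence 2^s. *)
Lemma upper_regular_trace nu (s c : R) x d : 0 <= c -> upper_regular nu s c -> 0 < d ->
  (nu (cube x d `&` msupport nu) <= (c * 2 `^ s * d `^ s)%:E)%E.
Proof.
move=> c0 nus d0.
have [->|/set0P[y [xy Sy]]] := eqVneq (cube x d `&` msupport nu) set0.
  by rewrite measure0 lee_fin !mulr_ge0 ?powR_ge0.
have d20 : 0 < 2 * d by rewrite mulr_gt0.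
rewrite -mulrA -powRM ?(ltW d0)//.
apply: le_trans (nus y _ Sy d20); apply: le_measure; rewrite ?inE.
- by apply: measurableI; [exact: measurable_cube|exact: measurable_msupport].
- exact: measurable_cube.
- move=> z [xz _] i; have := xz i; have := xy i.
  by rewrite !ltr_norml => /andP[a1 a2] /andP[b1 b2]; apply/andP; split; lra.
Qed.

(** [cap] is a supremum over compact subsets, so it suffices to bound the capacity of a compact K in
    E carrying half of the mass; the half costs 2^(-b). The capacity inequality is applied to nu
    restricted to K and its support. *)
Lemma isocapacitary (l : nat) (s c : R) : (0 < l)%N -> (2 * l < n)%N ->
  n%:R - (2 * l)%:R < s -> 0 < c ->
  exists2 C : R, 0 < C &
  forall nu, upper_regular nu s c ->
  forall x d (E : set rV) (M : R), 0 < d -> measurable E -> E `<=` cube x d ->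
    nu (E `&` msupport nu) = M%:E -> 0 < M ->
    ((C * M `^ ((n%:R - (2 * l)%:R) / s))%:E <= cap l E)%E.
Proof.
move=> l0 ln ns c0.
have c20 : 0 < c * 2 `^ s by rewrite mulr_gt0 ?powR_gt0.
have [C C0 HC] := @capacity_inequality R n l s _ l0 ln ns c20.
set b := (n%:R - (2 * l)%:R) / s in HC *.
have b0 : 0 <= b.
  have ln' : (2 * l)%:R < n%:R :> R by rewrite ltr_nat.
  by rewrite divr_ge0// ?subr_ge0 ltW//; apply: lt_trans ns; rewrite subr_gt0.
exists (C^-1 * (2^-1) `^ b); first by rewrite mulr_gt0 ?powR_gt0 ?invr_gt0.
move=> nu nus x d E M d0 mE Ex nE M0.
set S := msupport nu in nE *.
have mS : measurable S by exact: measurable_msupport.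
have mQ : measurable (cube x d `&` S).
  by apply: measurableI => //; exact: measurable_cube.
have Qoo : (nu (cube x d `&` S) < +oo)%E.
  by apply: le_lt_trans (upper_regular_trace x (ltW c0) nus d0) _; rewrite ltry.
pose m0 : {finite_measure set rV -> \bar R} := mfrestr mQ Qoo.
have M20 : 0 < M / 2 by rewrite divr_gt0.
(* Inner regularity is used for the restriction to the cube and the support, which is finite; K is
   bounded because E lies in the cube, hence compact. *)
have [K [cK KE mEK]] := inner_regular m0 mE M20.
have mK : measurable K := row_closed_measurable cK.
have m0E (A : set rV) : A `<=` E -> m0 A = nu (A `&` S).
  move=> AE; transitivity (nu (A `&` (cube x d `&` S))) => //.
  by rewrite setIA (@setIidl _ A)//; exact: subset_trans AE Ex.
have KSoo : (nu (K `&` S) < +oo)%E.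
  rewrite (le_lt_trans _ (_ : M%:E < +oo)%E) ?ltry// -nE le_measure ?inE//.
  - exact: measurableI.
  - exact: measurableI.
  - exact: setSI.
have mKS : measurable (K `&` S) by exact: measurableI.
pose m : {finite_measure set rV -> \bar R} := mfrestr mKS KSoo.
have KE2 : nu (K `&` S) = (fine (nu (K `&` S)))%:E by rewrite fineK// ge0_fin_numE.
have KM : M / 2 <= fine (nu (K `&` S)).
  have : (M%:E <= nu (K `&` S) + nu ((E `\` K) `&` S))%E.
    rewrite -nE -measureU//.
    - rewrite le_measure ?inE//.
      + exact: measurableI.
      + by apply: measurableU => //; apply: measurableI => //; exact: measurableD.
      + by move=> y [Ey Sy]; have [Ky|nKy] := pselect (K y); [left|right].
    - by apply: measurableI => //; exact: measurableD.
    - by apply/seteqP; split => // y [[Ky _] [[_ nKy] _]].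
  rewrite -(m0E (E `\` K)) => [h|]; last by move=> y [].
  have : (M%:E <= nu (K `&` S) + (M / 2)%:E)%E.
    by apply: le_trans h _; apply: leeD2l; exact: ltW.
  by rewrite KE2 -EFinD lee_fin; lra.
have compactK : compact K.
  apply: bounded_closed_compact => //; exists (`|x| + d); split; first exact: num_real.
  move=> r xr y /KE/Ex; rewrite cubeE//= => xy.
  rewrite (le_trans _ (ltW xr))// -[y](subrK x) addrC (le_trans (ler_normD _ _))//.
  rewrite lerD2l distrC ltW// (lt_trans xy)// ltr_pdivrMr// mulr2n mulrDr mulr1 ltrDl//.
apply: (@le_trans _ _ (compact_cap l K)); last first.
  by apply: ereal_sup_ubound; exists K.
apply: le_ereal_inf_tmp => _ [u [tu uK] <-].
have H : ((fine (nu (K `&` S)) `^ b)%:E <= C%:E * grad_norm2 l u)%E.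
  apply: (HC m _ K u) => //.
  - move=> y e e0; apply: le_trans (upper_regular_trace y (ltW c0) nus e0).
    apply: le_measure; rewrite ?inE.
    + by apply: measurableI => //; exact: measurable_cube.
    + by apply: measurableI => //; exact: measurable_cube.
    + by move=> z [? []].
  - by rewrite -KE2 -[in RHS](setTI (K `&` S)).
  - exact: lt_le_trans KM.
  - transitivity (nu (K `&` (K `&` S))) => //; rewrite setIA setIid.
    by rewrite -[in LHS](setTI (K `&` S)).
rewrite -mulrA EFinM -lee_pdivlMl ?invr_gt0// invrK.
apply: le_trans H; rewrite lee_fin -powRM ?(ltW M0)// ?invr_ge0//.
rewrite mulrC; apply: ge0_ler_powR => //; rewrite nnegrE.
  exact: ltW.
by rewrite (le_trans (ltW M20)).
Qed.

End isocapacitary.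

(** * The Otelbaev function *)

Section concentration.
Context {R : realType} {n : nat}.
Local Notation rV := 'rV[R]_n.
Implicit Types (x y : rV).

Definition tail_power (k h : R) (W : rV -> R) y : R := W y `^ k * (h < W y)%R%:R.

Lemma measurable_tail_power k h W : measurable_fun [set: rV] W ->
  measurable_fun [set: rV] (tail_power k h W).
Proof.
move=> mW; apply: measurable_funM.
  by apply: (measurableT_comp (f := @powR R ^~ k)); first exact: measurable_powR.
by apply: measurable_boolR; apply: measurable_fun_ltr.
Qed.

Lemma tail_power_ge0 k h W y : 0 <= tail_power k h W y.
Proof. by rewrite mulr_ge0 ?powR_ge0. Qed.

(* Integrated over E against m, with lam of order m(E)^(- sigma / s), this
   stands in for Hoelder's inequality. *)
Lemma le_tail_power (k h lam w : R) : 1 < k -> 0 <= w -> 0 <= h -> 0 < lam ->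
  w <= h + lam + lam `^ (1 - k) * (w `^ k * (h < w)%R%:R).
Proof.
move=> k1 w0 h0 lam0.
have [hw|wh] := ltP h w; last first.
  by rewrite !mulr0 addr0 (le_trans wh)// lerDl ltW.
have T0 : 0 <= lam `^ (1 - k) * w `^ k by rewrite mulr_ge0 ?powR_ge0.
rewrite mulr1; have [wl|lw] := leP w lam.
  by move: T0; set T := _ * _ => T0; lra.
have w1 : 0 < w by exact: lt_trans lw.
rewrite -[leLHS]add0r lerD ?addr_ge0 ?(ltW lam0)//.
rewrite -opprB powRN mulrC ler_pdivlMr ?powR_gt0//.
rewrite -[in X in _ <= X](subrK 1 k) (@powRD _ w (k - 1)) ?(gt_eqF w1) ?implybT// powRr1// mulrC.
rewrite ler_wpM2r//; apply: ge0_ler_powR; rewrite ?nnegrE ?subr_ge0 ltW//.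
Qed.

(** A set E of mass M satisfies mu(E) <= (h + lam) M + lam^(1 - s/sigma) e by splitting the values
    of W at h and lam. By scale invariance h0 and e do not depend on t, and every summand is a small
    multiple of M^b with b = (n - 2l)/s, hence of the capacity. *)
Lemma cube_concentration_lt (l : nat) (s tau c3 C1 : R) : (0 < l)%N -> (2 * l < n)%N ->
  n%:R - (2 * l)%:R < s -> 0 < tau -> 0 < c3 -> 0 < C1 ->
  let sigma := s - n%:R + (2 * l)%:R in
  exists h0 e, [/\ 0 < h0, 0 < e &
  forall (m : {measure set rV -> \bar R}) (W : rV -> R) mu x t,
    (forall y, 0 <= W y) -> measurable_fun [set: rV] W -> 0 < t ->
    (m (cube x t) <= (c3 * t `^ s)%:E)%E ->
    (forall E, measurable E -> E `<=` cube x t -> mu E = \int[m]_(y in E) (W y)%:E)%E ->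
    (forall E M, measurable E -> E `<=` cube x t -> m E = M%:E -> 0 < M ->
      ((C1 * M `^ ((n%:R - (2 * l)%:R) / s))%:E <= cap l E)%E) ->
    (\int[m]_(y in cube x t) (tail_power (s / sigma) (h0 * t `^ (- sigma)) W y)%:E < e%:E)%E ->
    (cube_concentration l mu x t < (tau^-1)%:E)%E].
Proof.
move=> l0 ln ns tau0 c30 C10 sigma.
have ln' : (2 * l)%:R < n%:R :> R by rewrite ltr_nat.
have s0 : 0 < s by apply: lt_trans ns; rewrite subr_gt0.
have sg0 : 0 < sigma by rewrite /sigma; lra.
have k1 : 1 < s / sigma by rewrite ltr_pdivlMr// mul1r /sigma; lra.
set b := (n%:R - (2 * l)%:R) / s.
have bE : b = 1 - sigma / s by rewrite /b /sigma; field; rewrite gt_eqF.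
(* The aim is C1 M^b / (2 tau): one half comes from h M, with h0 normalized by the largest possible
   mass c3 t^s, and the other half from 2 lam M = 2 e1 M^b. *)
pose e1 := C1 / (8 * tau).
have e10 : 0 < e1 by rewrite divr_gt0// mulr_gt0.
pose h0 := C1 / (4 * tau) / c3 `^ (sigma / s).
have h00 : 0 < h0 by rewrite !divr_gt0 ?powR_gt0// mulr_gt0.
exists h0, (e1 `^ (s / sigma)); split; rewrite ?powR_gt0//.
move=> m W mu x t W0 mW t0 mx muE capE A.
have mQ : measurable (cube x t) by exact: measurable_cube.
set h := h0 * t `^ (- sigma) in A.
have hp : 0 < h by rewrite mulr_gt0 ?powR_gt0.
(* A supremum of ratios only inherits a weak inequality, so 1/(2 tau) is aimed at in order to stay
   strictly below 1/tau. *)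
apply: (@le_lt_trans _ _ ((2 * tau)^-1)%:E); last first.
  by rewrite lte_fin ltf_pV2 ?posrE ?mulr_gt0// ltr_pMl// ltr1n.
apply: ge_ereal_sup => _ [E [mE EQ cE] <-].
suff muEle : (mu E <= (2 * tau)^-1%:E * cap l E)%E.
  rewrite /capacity_ratio; move: (cap l E) cE muEle => [r| |]//.
    by rewrite lte_fin => r0 H; rewrite inver gt_eqF// lee_pdivrMr.
  (* For infinite capacity the ratio is 0, because the inverse of +oo is 0. *)
  by move=> _ _; rewrite invey mule0 lee_fin invr_ge0 mulr_ge0// ltW.
have mEle : (m E <= m (cube x t))%E by apply: le_measure; rewrite ?inE.
have [M ME] : exists M, m E = M%:E.
  exists (fine (m E)); rewrite fineK// ge0_fin_numE//.
  by rewrite (le_lt_trans mEle)// (le_lt_trans mx)// ltry.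
have M0 : 0 <= M by rewrite -lee_fin -ME.
rewrite muE//.
have mWE : measurable_fun E (EFin \o W).
  by apply/measurable_EFinP; exact: measurable_funTS.
move: M0; rewrite le_eqVlt => /predU1P[M0|M0].
  rewrite null_set_integral//; last by rewrite ME -M0.
  by rewrite mule_ge0 ?lee_fin ?invr_ge0 ?mulr_ge0 ?(ltW tau0) ?(ltW cE).
have MB : M <= c3 * t `^ s by rewrite -lee_fin -ME (le_trans mEle).
have p0 : 0 < M `^ (sigma / s) by rewrite powR_gt0.
(* Makes the contribution lam^(1 - s/sigma) e of the tail equal to lam M. *)
pose lam := e1 / M `^ (sigma / s).
have lam0 : 0 < lam by rewrite divr_gt0.
have lamE : lam `^ (1 - s / sigma) * e1 `^ (s / sigma) = lam * M.
  rewrite powRD ?(gt_eqF lam0) ?implybT// powRr1 ?(ltW lam0)// -mulrA; congr (_ * _).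
  rewrite powRN {1}/lam powRM ?(ltW e10) ?invr_ge0 ?(ltW p0)//.
  have -> : (M `^ (sigma / s))^-1 `^ (s / sigma) = M^-1.
    rewrite -powRN -powRrM -(powR_inv1 (ltW M0)); congr powR.
    by field; rewrite !gt_eqF.
  by field; rewrite !gt_eqF ?powR_gt0.
have tp0 y : 0 <= tail_power (s / sigma) h W y by exact: tail_power_ge0.
have mtp (D : set rV) : measurable_fun D (fun y => (tail_power (s / sigma) h W y)%:E).
  by apply/measurable_EFinP; apply: measurable_funTS; exact: measurable_tail_power.
apply: (@le_trans _ _ ((h + lam) * M + lam * M)%:E).
  apply: (@le_trans _ _ (\int[m]_(y in E) ((h + lam)%:E +
      (lam `^ (1 - s / sigma))%:E * (tail_power (s / sigma) h W y)%:E)))%E.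
    apply: le_ge0_integral => y _; first by rewrite lee_fin.
    by rewrite -EFinM -EFinD lee_fin; apply: le_tail_power => //; exact: ltW.
  rewrite ge0_integralD//; last 3 first.
  - by move=> y _; rewrite lee_fin addr_ge0 ?ltW.
  - by move=> y _; rewrite mule_ge0 ?lee_fin ?powR_ge0.
  - by apply: emeasurable_funM => //; exact: mtp.
  rewrite [leRHS]EFinD; apply: leeD.
    by rewrite (integral_cst m mE) ME -EFinM.
  rewrite ge0_integralZl ?lee_fin ?powR_ge0//; last by move=> y _; rewrite lee_fin.
  rewrite -lamE EFinM; apply: lee_wpmul2l; first by rewrite lee_fin powR_ge0.
  apply: le_trans (ltW A); apply: ge0_subset_integral => //.
  by move=> y _; rewrite lee_fin.
apply: (@le_trans _ _ ((2 * tau)^-1%:E * (C1 * M `^ b)%:E)%E); last first.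
  by apply: lee_wpmul2l; [rewrite lee_fin invr_ge0 mulr_ge0// ltW|exact: capE].
rewrite -EFinM lee_fin.
have Mb : M `^ b * M `^ (sigma / s) = M.
  by rewrite -powRD ?bE ?subrK ?powRr1 ?(ltW M0)// (gt_eqF M0) implybT.
have hM : h * M `^ (sigma / s) <= C1 / (4 * tau).
  have : M `^ (sigma / s) <= c3 `^ (sigma / s) * t `^ sigma.
    have -> : t `^ sigma = (t `^ s) `^ (sigma / s).
      by rewrite -powRrM; congr (_ `^ _); field; rewrite gt_eqF.
    rewrite -powRM ?(ltW c30) ?powR_ge0//.
    apply: ge0_ler_powR; rewrite ?nnegrE ?divr_ge0 ?(ltW M0) ?(ltW sg0) ?(ltW s0)//.
    by rewrite mulr_ge0 ?powR_ge0 ?ltW.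
  move=> /(ler_wpM2l (ltW hp)) /le_trans; apply; apply: le_of_eq.
  rewrite /h /h0 powRN; field.
  by rewrite !gt_eqF ?powR_gt0.
have lp : lam * M `^ (sigma / s) = e1 by rewrite /lam divfK// gt_eqF.
have -> : (h + lam) * M + lam * M = M `^ b * (h * M `^ (sigma / s) + 2 * e1).
  by rewrite -lp -{1 2}Mb; ring.
rewrite [leRHS](_ : _ = M `^ b * (C1 / (4 * tau) + 2 * e1)); last first.
  by rewrite /e1; field; rewrite gt_eqF.
by rewrite ler_wpM2l ?powR_ge0// lerD2r.
Qed.

End concentration.

Section otelbaev_bound.
Context {R : realType} {n : nat}.
Local Notation rV := 'rV[R]_n.
Implicit Types (x y : rV).
Local Notation leb := (@lebesgue_row R n).

Lemma otelbaev_delta_ge0 l mu tau x : (0 <= @otelbaev_delta R n l mu tau x)%E.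
Proof. by rewrite /otelbaev_delta le_max lexx. Qed.

Lemma otelbaev_delta_ge l mu tau x (t : R) : 0 < t ->
  (cube_concentration l mu x t < (tau^-1)%:E)%E ->
  (t%:E <= @otelbaev_delta R n l mu tau x)%E.
Proof.
move=> t0 ct; rewrite /otelbaev_delta le_max; apply/orP; right.
by apply: ereal_sup_ubound; exists t.
Qed.

Lemma expey k : (0 < k)%N -> (+oo ^+ k = +oo :> \bar R)%E.
Proof.
elim: k => [//|[_ _|k IH _]]; first by rewrite expeS expe0 mule1.
by rewrite expeS IH// mulyy.
Qed.

(* The value +oo of q (zero delta) is absorbed because the terms of the sum
   are then bounded below by a multiple of [dyadic k `^ - p], k -> -oo. *)
Lemma otelbaev_q_le (l : nat) mu (tau p e : R) (A : int -> \bar R) x :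
  (0 < l)%N -> 0 < p -> 0 < e -> (forall k, 0 <= A k)%E ->
  (forall k, (otelbaev_delta l mu tau x < (dyadic k)%:E)%E -> (e%:E <= A k)%E) ->
  (otelbaev_q l mu tau x `^ (p / (2 * l)%:R) <=
   zsum (fun k => (2 `^ p / e * dyadic k `^ (- p))%:E * A k))%E.
Proof.
move=> l0 p0 e0 A0 H.
have l20 : 0 < (2 * l)%:R :> R by rewrite ltr0n muln_gt0.
have c0 k : 0 <= 2 `^ p / e * dyadic k `^ (- p).
  by rewrite mulr_ge0 ?powR_ge0 ?divr_ge0 ?powR_ge0// ltW.
have term_ge k : (otelbaev_delta l mu tau x < (dyadic k)%:E)%E ->
    ((2 `^ p * dyadic k `^ (- p))%:E <=
     zsum (fun k => (2 `^ p / e * dyadic k `^ (- p))%:E * A k))%E.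
  move=> /H eA; apply: le_trans (zsum_ge _ k).
  apply: (@le_trans _ _ ((2 `^ p / e * dyadic k `^ (- p))%:E * e%:E)%E).
    by rewrite -EFinM lee_fin; apply: le_of_eq; field; rewrite gt_eqF.
  by apply: lee_wpmul2l; rewrite ?lee_fin.
rewrite /otelbaev_q; have := otelbaev_delta_ge0 l mu tau x.
move: (otelbaev_delta l mu tau x) term_ge => [r| |]// term_ge; last first.
  move=> _; rewrite expey ?muln_gt0// invey poweR0r ?gt_eqF ?divr_gt0//.
  by apply: zsum_ge0 => k; rewrite mule_ge0 ?lee_fin.
rewrite lee_fin le_eqVlt => /predU1P[r0|r0].
  suff -> : zsum (fun k => (2 `^ p / e * dyadic k `^ (- p))%:E * A k)%E = +oo%E by rewrite leey.
  apply: eq_infty => B; pose B1 := Num.max B 1.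
  have B10 : 0 < B1 by rewrite lt_max ltr01 orbT.
  have [k /andP[kB _]] := @dyadic_floor R (B1 `^ (- p^-1)) (powR_gt0 _ B10).
  apply: le_trans (term_ge k _); last by rewrite -r0 lte_fin dyadic_gt0.
  rewrite lee_fin (@le_trans _ _ B1)//; first by rewrite le_max lexx.
  have -> : B1 = 1 * (B1 `^ (- p^-1)) `^ (- p).
    by rewrite mul1r -powRrM mulrNN mulVf ?gt_eqF// powRr1 ?ltW.
  apply: ler_pM; [exact: ler01|exact: powR_ge0| |].
    by rewrite -{1}(powRr0 (2 : R)) ler_powR ?ler1n ?ltW.
  have dp0 : 0 < dyadic k `^ p :> R := powR_gt0 _ (dyadic_gt0 k).
  have Bp0 : 0 < (B1 `^ (- p^-1)) `^ p := powR_gt0 _ (powR_gt0 _ B10).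
  rewrite (powRN (dyadic k)) (powRN (B1 `^ _)) lef_pV2 ?posrE//.
  by apply: ge0_ler_powR; rewrite ?nnegrE ?powR_ge0 ?dyadic_ge0// ltW.
(* The next scale 2^(k+1) exceeds delta by a factor of at most 2; this is the origin of the constant
   2^p. *)
have [k /andP[kr rk]] := dyadic_floor r0.
apply: (@le_trans _ _ (2 `^ p * dyadic (k + 1) `^ (- p))%:E); last first.
  by apply: term_ge; rewrite lte_fin.
rewrite -EFin_expe inver gt_eqF ?exprn_gt0// poweR_EFin lee_fin.
have -> : (r ^+ (2 * l))^-1 `^ (p / (2 * l)%:R) = r `^ (- p).
  rewrite -powR_mulrn ?(ltW r0)// -powRN -powRrM; congr powR.
  by field; rewrite pnatr_eq0 -lt0n.
rewrite dyadicS powRM ?dyadic_ge0// mulrA -powRD ?pnatr_eq0 ?implybT// subrr powRr0 mul1r.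
rewrite !powRN lef_pV2 ?posrE ?powR_gt0 ?dyadic_gt0//.
by apply: ge0_ler_powR; rewrite ?nnegrE ?dyadic_ge0 ?(ltW p0) ?(ltW r0).
Qed.

End otelbaev_bound.

(** * Integration over space and summation over scales *)

Section otelbaev_integral.
Context {R : realType} {n : nat}.
Local Notation rV := 'rV[R]_n.
Implicit Types (x y : rV).
Local Notation leb := (@lebesgue_row R n).

(** The truncation keeps only scales above (h0/w)^(1/sigma), so the geometric sum of 2^(-jb) is of
    order (w/h0)^(b/sigma) and raises the exponent of w by b/sigma. *)
Lemma tail_power_sum_le (sigma b k h0 a w : R) : 0 < sigma -> 0 < b -> 0 < h0 ->
  0 <= a -> 0 <= w ->
  (zsum (fun j => (a * dyadic j `^ (- b) *
      (w `^ k * (h0 * dyadic j `^ (- sigma) < w)%R%:R))%:E) <=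
   (a * geo b * h0 `^ (- (b / sigma)) * w `^ (k + b / sigma))%:E)%E.
Proof.
move=> sg0 b0 h00 a0; rewrite le_eqVlt => /predU1P[<-|w0].
  rewrite /zsum esum1; first by rewrite lee_fin !mulr_ge0 ?powR_ge0 ?geo_ge0.
  move=> j _; rewrite ltNge (_ : 0 <= _); last by rewrite mulr_ge0 ?powR_ge0 ?ltW.
  by rewrite !mulr0.
pose q := (h0 / w) `^ sigma^-1.
have hw0 : 0 < h0 / w by rewrite divr_gt0.
have q0 : 0 < q by rewrite powR_gt0.
apply: (@le_trans _ _ ((a * w `^ k)%:E *
    zsum (fun j => (dyadic j `^ (- b) * (q <= dyadic j)%R%:R)%:E))%E).
  rewrite -zsumZl ?mulr_ge0 ?powR_ge0//; last first.
    by move=> j; rewrite lee_fin mulr_ge0 ?powR_ge0.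
  apply: le_zsum => j; rewrite -EFinM lee_fin.
  rewrite [leLHS](_ : _ = a * w `^ k * (dyadic j `^ (- b) *
    (h0 * dyadic j `^ (- sigma) < w)%R%:R)); last by ring.
  rewrite ler_wpM2l ?mulr_ge0 ?powR_ge0// ler_wpM2l ?powR_ge0// ler_nat.
  case: ltP => // hj; rewrite (_ : (q <= dyadic j) = true)//.
  have dE : dyadic j = (dyadic j `^ sigma) `^ sigma^-1 :> R.
    by rewrite -powRrM mulfV ?gt_eqF// powRr1 ?dyadic_ge0.
  rewrite /q [X in _ <= X]dE; apply: ge0_ler_powR.
  - by rewrite invr_ge0 ltW.
  - by rewrite nnegrE ltW.
  - by rewrite nnegrE powR_ge0.
  move: hj; rewrite powRN ltr_pdivrMr ?powR_gt0 ?dyadic_gt0// => hj.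
  by rewrite ler_pdivrMr// mulrC ltW.
apply: le_trans (lee_wpmul2l _ (dyadic_ge_sum b0 q0)) _.
  by rewrite lee_fin mulr_ge0 ?powR_ge0.
rewrite -EFinM lee_fin; apply: le_of_eq.
have -> : q `^ (- b) = h0 `^ (- (b / sigma)) * w `^ (b / sigma).
  rewrite /q -powRrM powRM ?(ltW h00) ?invr_ge0 ?(ltW w0)//.
  congr (_ * _); first by congr powR; ring.
  rewrite -(powR_inv1 (ltW w0)) -powRrM; congr powR; ring.
rewrite powRD ?(gt_eqF w0) ?implybT// /geo; ring.
Qed.

(** Stated for a sigma-finite m, as Tonelli requires, and for a density on the whole space; the
    measure on the support and the density extended by zero are substituted at the end. *)
Lemma otelbaev_integral_le (l : nat) (s gamma tau c3 C1 : R) : (0 < l)%N -> (2 * l < n)%N ->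
  n%:R - (2 * l)%:R < s -> 0 < gamma -> 0 < tau -> 0 < c3 -> 0 < C1 ->
  let kappa := (s + (2 * l)%:R * gamma) / (s - n%:R + (2 * l)%:R) in
  exists2 C : R, 0 < C &
  forall (m : {sigma_finite_measure set rV -> \bar R}) (W : rV -> R) mu,
    (forall y, 0 <= W y) -> measurable_fun [set: rV] W ->
    (forall x t, 0 < t -> (m (cube x t) <= (c3 * t `^ s)%:E)%E) ->
    (forall E, measurable E -> mu E = \int[m]_(y in E) (W y)%:E)%E ->
    (forall x t E M, 0 < t -> measurable E -> E `<=` cube x t -> m E = M%:E -> 0 < M ->
      ((C1 * M `^ ((n%:R - (2 * l)%:R) / s))%:E <= cap l E)%E) ->
    (\int[leb]_x (otelbaev_q l mu tau x `^ (n%:R / (2 * l)%:R + gamma)) <=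
      C%:E * \int[m]_y (W y `^ kappa)%:E)%E.
Proof.
move=> l0 ln ns gam0 tau0 c30 C10 kappa.
pose sigma := s - n%:R + (2 * l)%:R.
have [h0 [e [h00 e0 conc]]] := cube_concentration_lt l0 ln ns tau0 c30 C10.
rewrite -/sigma in conc.
have n0 : (0 < n)%N by apply: leq_ltn_trans ln.
have l20 : 0 < (2 * l)%:R :> R by rewrite ltr0n muln_gt0.
have sg0 : 0 < sigma by rewrite /sigma; lra.
pose b := (2 * l)%:R * gamma; have b0 : 0 < b by rewrite mulr_gt0.
pose p := n%:R + b; have p0 : 0 < p by rewrite addr_gt0// ltr0n.
(* The exponent kappa is the scale-invariant exponent s/sigma plus the gain b/sigma from the sum
   over scales. *)
have kE : kappa = s / sigma + b / sigma by rewrite /kappa -mulrDl.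
have [a a0 aE] : exists2 a, 0 < a & a = 2 `^ p / e.
  by eexists; last by []; rewrite divr_gt0 ?powR_gt0.
have K0 : 0 < a * geo b * h0 `^ (- (b / sigma)) by rewrite !mulr_gt0 ?powR_gt0 ?geo_gt0.
exists (a * geo b * h0 `^ (- (b / sigma))) => //.
move=> m W mu W0 mW mcube muE capE.
pose phi (k : int) y := tail_power (s / sigma) (h0 * dyadic k `^ (- sigma)) W y.
have phi0 k y : 0 <= phi k y by exact: tail_power_ge0.
have mphi k : measurable_fun [set: rV] (phi k) by exact: measurable_tail_power.
pose F k (q : rV * rV) : \bar R := ((`|q.1 - q.2| < dyadic k / 2)%R%:R * phi k q.2)%:E.
have F0 k q : (0 <= F k q)%E by rewrite lee_fin mulr_ge0.
have mF k : measurable_fun [set: rV * rV] (F k).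
  apply/measurable_EFinP; apply: measurable_funM.
    by apply: measurable_boolR; exact: measurable_dist_lt.
  exact: (measurableT_comp (mphi k) measurable_snd).
pose A k x := (\int[m]_y F k (x, y))%E.
have A0 k x : (0 <= A k x)%E by apply: integral_ge0 => y _; exact: F0.
have mA k : measurable_fun [set: rV] (A k).
  exact: (measurable_fun_fubini_tonelli_F _ (mF k) (F0 k)).
have AE k x : (\int[m]_(y in cube x (dyadic k)) (phi k y)%:E = A k x)%E.
  rewrite integral_mkcond; apply: eq_integral => y _.
  rewrite patchE /F /= cubeE ?dyadic_gt0//.
  have [xy|xy] := boolP (`|x - y| < dyadic k / 2).
    by rewrite mem_set// mul1r.
  by rewrite memNset ?mul0r//; exact/negP.
have expE : n%:R / (2 * l)%:R + gamma = p / (2 * l)%:R.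
  by rewrite /p /b mulrDl [X in _ = _ + X]mulrAC mulfV ?gt_eqF// mul1r.
rewrite expE.
have ck0 k : 0 <= a * dyadic k `^ (- p) by rewrite mulr_ge0 ?powR_ge0 ?ltW.
apply: (@le_trans _ _ (\int[leb]_x
    zsum (fun k => (a * dyadic k `^ (- p))%:E * A k x))%E).
  apply: le_ge0_integral => x _; first exact: poweR_ge0.
  rewrite aE; apply: otelbaev_q_le => // k dk; rewrite -AE leNgt; apply/negP => Ae.
  move: dk; rewrite ltNge => /negP; apply; apply: otelbaev_delta_ge => //.
  apply: (conc m W mu x (dyadic k)) => //.
  - by apply: mcube.
  - by move=> E mE _; exact: muE.
  - by move=> E M mE EQ mM M0; apply: (capE x (dyadic k)) => //; exact: dyadic_gt0.
rewrite integral_zsum; last 2 first.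
- by move=> k; apply: emeasurable_funM.
- by move=> k x; rewrite mule_ge0// lee_fin.
(* For fixed y the points x whose cube contains y fill the volume 2^(kn), which lowers the decay
   from p = n + b to b. *)
have intA k : (\int[leb]_x ((a * dyadic k `^ (- p))%:E * A k x) =
    \int[m]_y (a * dyadic k `^ (- b) * phi k y)%:E)%E.
  rewrite ge0_integralZl ?lee_fin//.
  rewrite /A (fubini_tonelli (F k))//.
  under eq_integral => y _.
    rewrite (_ : (\int[leb]_x F k (x, y) = (dyadic k ^+ n)%:E * (phi k y)%:E)%E); last first.
      rewrite /F /=; under eq_integral do rewrite EFinM.
      rewrite ge0_integralZr ?lee_fin//; last first.
        apply/measurable_EFinP; apply: measurable_boolR.
        exact: (measurableT_comp (measurable_dist_lt _) (measurable_pair2 y)).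
      congr (_ * _)%E.
      have d20 : 0 < dyadic k / 2 :> R by rewrite divr_gt0 ?dyadic_gt0.
      have mB : measurable [set x : rV | `|y - x| < dyadic k / 2].
        rewrite -[X in measurable X]setTI.
        by apply: (measurableT_comp (measurable_dist_lt _) (measurable_pair1 y)).
      transitivity (leb [set x : rV | `|y - x| < dyadic k / 2]).
        have := integral_indic leb measurableT mB.
        rewrite setIT => <-; apply: eq_integral => x _.
        rewrite indicE distrC; congr ((nat_of_bool _)%:R%:E).
        by apply/idP/idP; rewrite inE.
      by rewrite lebesgue_row_ball// mulrC divfK.
    over.
  rewrite -ge0_integralZl ?lee_fin//; last 2 first.
  - by apply: emeasurable_funM => //; exact/measurable_EFinP.
  - by move=> y _; rewrite mule_ge0 ?lee_fin ?exprn_ge0 ?dyadic_ge0.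
  apply: eq_integral => y _; rewrite -!EFinM; congr EFin.
  rewrite mulrA; congr (_ * _); rewrite -mulrA; congr (_ * _).
  rewrite -powR_mulrn ?dyadic_ge0// -powRD ?(gt_eqF (dyadic_gt0 _)) ?implybT//.
  by congr powR; rewrite /p; ring.
under [X in zsum X]eq_fun do rewrite intA.
rewrite -integral_zsum; last 2 first.
- by move=> k; apply/measurable_EFinP; apply: measurable_funM.
- by move=> k y; rewrite lee_fin mulr_ge0// mulr_ge0 ?powR_ge0// ltW.
have mWk : measurable_fun [set: rV] (fun y => (W y `^ kappa)%:E).
  apply/measurable_EFinP.
  by apply: (measurableT_comp (f := @powR R ^~ kappa)); first exact: measurable_powR.
rewrite -ge0_integralZl ?lee_fin ?(ltW K0)//; last by move=> y _; rewrite lee_fin powR_ge0.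
apply: le_ge0_integral => y _.
  by apply: zsum_ge0 => k; rewrite lee_fin mulr_ge0// mulr_ge0 ?powR_ge0// ltW.
by rewrite -EFinM kE; apply: tail_power_sum_le => //; exact: ltW.
Qed.

End otelbaev_integral.

(** * Restriction to the support and conclusion *)

Section sigma_finite_restriction.
Context d (T : measurableType d) (R : realType).
Variables (mu : {measure set T -> \bar R}) (D : set T) (mD : measurable D).
Hypothesis sD : sigma_finite setT (mrestr mu mD).

(** The proof argument is a phantom that lets the sigma-finite structure be attached to the
    restricted measure. *)
Definition sfrestr (_ : sigma_finite setT (mrestr mu mD)) := mrestr mu mD.

HB.instance Definition _ := Measure.on (sfrestr sD).

HB.instance Definition _ := Measure_isSigmaFinite.Build _ _ _ (sfrestr sD) sD.

Lemma integral_sfrestr (E : set T) (f : T -> \bar R) : measurable E ->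
  (\int[mu]_(x in E `&` D) f x = \int[sfrestr sD]_(x in E) (f \_ D) x)%E.
Proof.
move=> mE; rewrite -integral_mkcondr; apply: eq_measure_integral => A mA AED.
transitivity (mu (A `&` D)) => //.
by rewrite setIidl// => x /AED[].
Qed.

End sigma_finite_restriction.

Lemma upper_regular_sigma_finite (R : realType) (n : nat)
    (nu : {measure set 'rV[R]_n -> \bar R}) (s c : R) : 0 <= c -> upper_regular nu s c ->
  sigma_finite setT (mrestr nu (measurable_msupport nu)).
Proof.
move=> c0 nus; exists (fun k => cube (0 : 'rV[R]_n) k.+1%:R).
  apply/esym; rewrite -subTset => x _; exists (Num.bound (2 * `|x|)) => //.
  rewrite cubeE ?ltr0n//= sub0r normrN ltr_pdivlMr// mulrC.
  apply: lt_le_trans (archi_boundP _) _; first by rewrite mulr_ge0.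
  by rewrite ler_nat.
move=> k; split; first exact: measurable_cube.
rewrite /mrestr; apply: le_lt_trans (upper_regular_trace _ c0 nus _) _ => //.
exact: ltry.
Qed.

Theorem proposition6p5 (R : realType) (N l : nat) (s gamma tau c c' : R) :
  (0 < l)%N -> (2 * l < N)%N ->
  N%:R - (2 * l)%:R < s -> 0 < gamma -> 0 < tau -> 0 < c -> 0 < c' ->
  let kappa := (s + (2 * l)%:R * gamma) / (s - N%:R + (2 * l)%:R) in
  exists C : R,
    forall (nu : {measure set 'rV[R]_N -> \bar R}) (V : 'rV[R]_N -> R),
    let Sigma := msupport nu in
    let mu := density_measure nu Sigma V in
    locally_finite nu ->
    ahlfors_regular nu s c c' ->
    (forall x, Sigma x -> 0 <= V x) ->
    measurable_fun Sigma V ->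
    finite_norm nu kappa%:E (V \_ Sigma) ->
    (forall x d, 0 < d -> mu (boundary (cube x d)) = 0%E) ->
    (\int[@lebesgue_row R N]_x
        (otelbaev_q l mu tau x `^ (N%:R / (2 * l)%:R + gamma))
      <= C%:E * \int[nu]_(x in Sigma) (V x `^ kappa)%:E)%E.
Proof.
move=> l0 lN Ns gam0 tau0 c0 _ kappa.
have c30 : 0 < c * 2 `^ s by rewrite mulr_gt0 ?powR_gt0.
have [C1 C10 HC1] := isocapacitary l0 lN Ns c0.
have [C C0 HC] := otelbaev_integral_le l0 lN Ns gam0 tau0 c30 C10.
exists C => nu V Sigma mu _ [nus _] V0 mV _ _.
have mS : measurable Sigma := measurable_msupport nu.
have sf := upper_regular_sigma_finite (ltW c0) nus.
have kap0 : kappa != 0.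
  have sg0 : 0 < s - N%:R + (2 * l)%:R by lra.
  have s0 : 0 < s.
    by apply: lt_trans Ns; rewrite subr_gt0 ltr_nat.
  by rewrite gt_eqF// divr_gt0// addr_gt0// mulr_gt0// ltr0n muln_gt0.
have := HC (sfrestr sf) (V \_ Sigma) mu.
rewrite -/kappa.
have -> : (\int[nu]_(x in Sigma) (V x `^ kappa)%:E =
    \int[sfrestr sf]_x ((V \_ Sigma) x `^ kappa)%:E)%E.
  rewrite -[Sigma in LHS]setTI (integral_sfrestr sf)//.
  apply: eq_integral => x _; rewrite !patchE; case: ifPn => // _.
  by rewrite powR0.
apply.
- by move=> y; rewrite patchE; case: ifPn => // /set_mem/V0.
- exact/(measurable_restrictT _ _).1.
- by move=> x t t0; apply: upper_regular_trace => //; exact: ltW.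
- move=> E mE; rewrite /mu /density_measure (integral_sfrestr sf)//.
  apply: eq_integral => x _; rewrite !patchE.
  by case: ifPn.
- by move=> x t E M t0 mE Ex EM M0; apply: (HC1 nu nus x t).
Qed.
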